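(* For every $n\geqslant2$ and every $t\in SRT_n$ fix an orientation $\omega_t$ of $t$ and write $m_t:=(t,\omega_t)\in\Omega BAs(n)$. Then there exist signs $\varepsilon_t\in\{\pm1\}$ (for $t\in BRT_n$, $n\geqslant2$) and a morphism of operads in dg-$\mathbb Z$-modules $A_\infty\to\Omega BAs$ given on the generating operations of $A_\infty$ by $$m_n\longmapsto\sum_{t\in BRT_n}\varepsilon_t\,m_t .$$
   Context: Operads are non-symmetric; dg-$\mathbb Z$-modules use cohomological grading (differential of degree $+1$) and the Koszul sign rule. The operad $A_\infty$ is the quasi-free operad generated in each arity $n\geqslant2$ by one operation $m_n$ of degree $2-n$, with differential $\partial m_n=-\sum_{i_1+i_2+i_3=n,\ 2\leqslant i_2\leqslant n-1}(-1)^{i_1+i_2i_3}m_{i_1+1+i_3}(\mathrm{id}^{\otimes i_1}\otimes m_{i_2}\otimes\mathrm{id}^{\otimes i_3})$. A ribbon tree is a planar rooted tree with one outgoing external edge and $n$ incoming external edges ordered from left to right. It is stable if all vertices are at least trivalent, binary if all are trivalent; $SRT_n$ and $BRT_n$ ($n\geqslant2$) are the sets of stable, resp. binary, ribbon trees with $n$ incoming edges. A broken stable ribbon tree $t_{br}$ is a stable ribbon tree some of whose internal edges are declared broken; the other internal edges are its finite internal edges. An orientation $\omega=e_1\wedge\cdots\wedge e_i$ of $t_{br}$ is an ordering of its finite internal edges up to even permutation; $-\omega$ is the opposite orientation. The operad $\Omega BAs$: $\Omega BAs(n)$ is the $\mathbb Z$-module generated by pairs $(t_{br},\omega)$ ($t_{br}$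 a broken stable ribbon tree with $n$ incoming edges, $\omega$ an orientation) modulo $(t_{br},-\omega)=-(t_{br},\omega)$ (together with the operadic unit in arity 1); $(t_{br},\omega)$ has degree minus the number of finite internal edges. Partial compositions are $(t_{br},\omega)\circ_k(t'_{br},\omega')=(t_{br}\circ_kt'_{br},\omega\wedge\omega')$, where $t'_{br}$ is grafted onto the $k$-th incoming edge of $t_{br}$ and the resulting edge is broken. The differential sends $(t_{br},e_1\wedge\cdots\wedge e_i)$ to $$\sum_{j=1}^i(-1)^j\Big((t_{br}/e_j,\,e_1\wedge\cdots\wedge\widehat{e_j}\wedge\cdots\wedge e_i)-((t_{br})_j,\,e_1\wedge\cdots\wedge\widehat{e_j}\wedge\cdots\wedge e_i)\Big),$$ where $t_{br}/e_j$ is obtained by collapsing $e_j$ and $(t_{br})_j$ by breaking $e_j$. *)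

(* Defs.v *)
From HB Require Import structures.
From mathcomp Require Import all_boot all_order all_algebra.
From mathcomp Require Import boolp.
From mathcomp Require Import zify.

Set Implicit Arguments.
Unset Strict Implicit.
Unset Printing Implicit Defensive.

Import GRing.Theory.
Local Open Scope ring_scope.
Local Open Scope quotient_scope.

(* The indices of a partial composition x o_(k+1) y, for x of arity m and degree
   i and y of arity n and degree j; the positions k are numbered from 0.  The
   arity p and the degree l of the result are variables related to m, n, i, j
   by equations, so that no transport is needed in the operad laws. *)
Definition composable (k m n p : nat) (i j l : int) : bool :=
  [&& (k < m)%N, (m + n == p.+1)%N & i + j == l].

(* Non-symmetric operads in graded Z-modules: op_car P n i is the component of
   arity n and degree i.  The two associativity laws are
     (x o_k y) o_(k+k'-1) z = x o_k (y o_k' z)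
     (x o_k' z) o_k y = (-1)^(|y||z|) (x o_k y) o_(k'+n-1) z      for k < k'
   with k, k' shifted by one here, since positions are numbered from 0. *)
Record gradedOperad := GradedOperad {
  op_car :> nat -> int -> zmodType;
  op_id : op_car 1 0;
  op_comp : forall (k m n p : nat) (i j l : int), composable k m n p i j l ->
    op_car m i -> op_car n j -> op_car p l;
  op_compDl : forall k m n p i j l (h : composable k m n p i j l) x x' y,
    op_comp h (x + x') y = op_comp h x y + op_comp h x' y;
  op_compDr : forall k m n p i j l (h : composable k m n p i j l) x y y',
    op_comp h x (y + y') = op_comp h x y + op_comp h x y';
  op_id_l : forall n j (h : composable 0 1 n n 0 j j) y, op_comp h op_id y = y;
  op_id_r : forall k m i (h : composable k m 1 m i 0 i) x, op_comp h x op_id = x;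
  op_seq : forall k k' m n p q r s (i j l a b c : int)
    (h1 : composable k m n q i j a) (h2 : composable (k + k') q p s a l c)
    (h3 : composable k' n p r j l b) (h4 : composable k m r s i b c) x y z,
    op_comp h2 (op_comp h1 x y) z = op_comp h4 x (op_comp h3 y z);
  op_par : forall k k' m n p q r s (i j l a b c : int), (k < k')%N ->
    forall (h1 : composable k m n q i j a)
      (h2 : composable (k' + n).-1 q p s a l c)
      (h3 : composable k' m p r i l b) (h4 : composable k r n s b j c) x y z,
    op_comp h4 (op_comp h3 x z) y
      = op_comp h2 (op_comp h1 x y) z *~ (-1) ^+ absz (j * l)
}.

Record gradedMorphism (P Q : gradedOperad) := GradedMorphism {
  gm_fun :> forall n i, P n i -> Q n i;
  gm_add : forall n i (x y : P n i), gm_fun (x + y) = gm_fun x + gm_fun y;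
  gm_id : gm_fun (op_id P) = op_id Q;
  gm_comp : forall k m n p i j l (h : composable k m n p i j l) x y,
    gm_fun (op_comp h x y) = op_comp h (gm_fun x) (gm_fun y)
}.

Record dgOperad := DgOperad {
  dg_op :> gradedOperad;
  dg_d : forall n i, dg_op n i -> dg_op n (i + 1);
  dg_dD : forall n i (x y : dg_op n i), dg_d (x + y) = dg_d x + dg_d y;
  dg_dd : forall n i (x : dg_op n i), dg_d (dg_d x) = 0;
  dg_leibniz : forall k m n p i j l (h : composable k m n p i j l)
    (hl : composable k m n p (i + 1) j (l + 1))
    (hr : composable k m n p i (j + 1) (l + 1)) x y,
    dg_d (op_comp h x y)
      = op_comp hl (dg_d x) y + op_comp hr x (dg_d y) *~ (-1) ^+ absz i
}.

Record dgMorphism (P Q : dgOperad) := DgMorphism {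
  dgm_mor :> gradedMorphism P Q;
  dgm_d : forall n i (x : P n i), dgm_mor _ _ (dg_d x) = dg_d (dgm_mor _ _ x)
}.

Lemma sgE (V : zmodType) (x : V) e : x *~ (-1) ^+ e = if odd e then - x else x.
Proof. by rewrite -signr_odd; case: (odd e); rewrite ?expr1 ?mulrN1z ?expr0 ?mulr1z. Qed.

Section Total.
Variable P : gradedOperad.

(* op_comp extended by 0 to all indices. *)
Definition cmp k m n p i j l (x : P m i) (y : P n j) : P p l :=
  if composable k m n p i j l =P true is ReflectT h then op_comp h x y else 0.

Lemma cmpE k m n p i j l (h : composable k m n p i j l) x y :
  cmp k p l x y = op_comp h x y.
Proof.
by rewrite /cmp; case: eqP => // h'; congr (op_comp _ x y); apply: bool_irrelevance.
Qed.

Lemma cmp_bad k m n p i j l (x : P m i) (y : P n j) :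
  ~~ composable k m n p i j l -> cmp k p l x y = 0.
Proof. by rewrite /cmp => h; case: eqP => // h'; rewrite h' in h. Qed.

Lemma cmpDl k m n p i j l (x x' : P m i) (y : P n j) :
  cmp k p l (x + x') y = cmp k p l x y + cmp k p l x' y.
Proof. by rewrite /cmp; case: eqP => h; rewrite ?addr0 ?op_compDl. Qed.

Lemma cmpDr k m n p i j l (x : P m i) (y y' : P n j) :
  cmp k p l x (y + y') = cmp k p l x y + cmp k p l x y'.
Proof. by rewrite /cmp; case: eqP => h; rewrite ?addr0 ?op_compDr. Qed.

Lemma cmp0l k m n p i j l (y : P n j) : cmp k p l (0 : P m i) y = 0.
Proof. by apply: (@addrI _ (cmp k p l (0 : P m i) y)); rewrite -cmpDl !addr0. Qed.

Lemma cmp0r k m n p i j l (x : P m i) : cmp k p l x (0 : P n j) = 0.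
Proof. by apply: (@addrI _ (cmp k p l x (0 : P n j))); rewrite -cmpDr !addr0. Qed.

Lemma cmpNl k m n p i j l (x : P m i) (y : P n j) :
  cmp k p l (- x) y = - cmp k p l x y.
Proof. by apply: (@addrI _ (cmp k p l x y)); rewrite -cmpDl !subrr cmp0l. Qed.

Lemma cmpNr k m n p i j l (x : P m i) (y : P n j) :
  cmp k p l x (- y) = - cmp k p l x y.
Proof. by apply: (@addrI _ (cmp k p l x y)); rewrite -cmpDr !subrr cmp0r. Qed.

Lemma cmp_suml (I : Type) (s : seq I) (A : pred I) k m n p i j l
    (F : I -> P m i) (y : P n j) :
  cmp k p l (\sum_(t <- s | A t) F t) y = \sum_(t <- s | A t) cmp k p l (F t) y.
Proof.
elim/big_rec2: _ => [|t u v _ <-]; first exact: cmp0l.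
by rewrite cmpDl.
Qed.

Lemma cmp_sumr (I : Type) (s : seq I) (A : pred I) k m n p i j l
    (F : I -> P n j) (x : P m i) :
  cmp k p l x (\sum_(t <- s | A t) F t) = \sum_(t <- s | A t) cmp k p l x (F t).
Proof.
elim/big_rec2: _ => [|t u v _ <-]; first exact: cmp0r.
by rewrite cmpDr.
Qed.

Lemma cmpSl k m n p i j l (x : P m i) (y : P n j) e :
  cmp k p l (x *~ (-1) ^+ e) y = cmp k p l x y *~ (-1) ^+ e.
Proof. by rewrite !sgE; case: odd; rewrite ?cmpNl. Qed.

Lemma cmpSr k m n p i j l (x : P m i) (y : P n j) e :
  cmp k p l x (y *~ (-1) ^+ e) = cmp k p l x y *~ (-1) ^+ e.
Proof. by rewrite !sgE; case: odd; rewrite ?cmpNr. Qed.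

Lemma cmp_seq k k' m n p q r s (i j l a b c : int) :
  composable k m n q i j a -> composable (k + k') q p s a l c ->
  composable k' n p r j l b -> composable k m r s i b c ->
  forall (x : P m i) (y : P n j) (z : P p l),
  cmp (k + k') s c (cmp k q a x y) z = cmp k s c x (cmp k' r b y z).
Proof. by move=> h1 h2 h3 h4 x y z; rewrite !cmpE; exact: op_seq. Qed.

Lemma cmp_par k k' m n p q r s (i j l a b c : int) : (k < k')%N ->
  composable k m n q i j a -> composable (k' + n).-1 q p s a l c ->
  composable k' m p r i l b -> composable k r n s b j c ->
  forall (x : P m i) (y : P n j) (z : P p l),
  cmp k s c (cmp k' r b x z) y
   = cmp (k' + n).-1 s c (cmp k q a x y) z *~ (-1) ^+ absz (j * l).
Proof. by move=> kk h1 h2 h3 h4 x y z; rewrite !cmpE; exact: op_par. Qed.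

End Total.

Arguments cmp {P} k {m n} p {i j} l x y.

Lemma gm0 P Q (f : gradedMorphism P Q) n i : f n i 0 = 0.
Proof. by apply: (@addrI _ (f n i 0)); rewrite -gm_add !addr0. Qed.

Lemma gm_cmp P Q (f : gradedMorphism P Q) k m n p i j l (x : P m i) (y : P n j) :
  f _ _ (cmp k p l x y) = cmp k p l (f _ _ x) (f _ _ y).
Proof. by rewrite /cmp; case: eqP => h; rewrite ?gm_comp ?gm0. Qed.

Lemma odd_absD (i j : int) : odd (absz (i + j)) = odd (absz i) (+) odd (absz j).
Proof. lia. Qed.

Ltac comp_lia := unfold composable in *; lia.

(* dual_operad numbers P[eps] *)
(* The operad P[eps] with eps of degree -1, eps^2 = 0, whose degree i component
   is P_i + eps P_(i+1).  A morphism of graded operads Q -> P[eps] is a morphism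
   f : Q -> P together with a degree 1 derivation along f. *)
Section Dual.
Variable P : gradedOperad.
Definition dual_car n i : zmodType := (P n i * P n (i + 1)%R)%type.
Definition dual_comp k m n p i j l (h : composable k m n p i j l)
    (x : dual_car m i) (y : dual_car n j) : dual_car p l :=
  (cmp k p l x.1 y.1,
   cmp k p (l + 1) x.2 y.1 + cmp k p (l + 1) x.1 y.2 *~ (-1) ^+ absz i).

Lemma sgD (V : zmodType) (x y : V) e :
  (x + y) *~ (-1) ^+ e = x *~ (-1) ^+ e + y *~ (-1) ^+ e.
Proof. exact: mulrzDl. Qed.

Fact dual_compDl k m n p i j l (h : composable k m n p i j l) x x' y :
  dual_comp h (x + x') y = dual_comp h x y + dual_comp h x' y.
Proof.
case: x x' y => [x1 x2] [x1' x2'] [y1 y2].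
congr pair; rewrite /= !cmpDl ?sgD //; exact: addrACA.
Qed.
Fact dual_compDr k m n p i j l (h : composable k m n p i j l) x y y' :
  dual_comp h x (y + y') = dual_comp h x y + dual_comp h x y'.
Proof.
case: x y y' => [x1 x2] [y1' y2'] [y1 y2].
congr pair; rewrite /= !cmpDr ?sgD //; exact: addrACA.
Qed.

Lemma cmp_id_l n j (h : composable 0 1 n n 0 j j) (y : P n j) : 
  cmp 0 n j (op_id P) y = y.
Proof. by rewrite cmpE op_id_l. Qed.
Lemma cmp_id_r k m i (h : composable k m 1 m i 0 i) (x : P m i) : 
  cmp k m i x (op_id P) = x.
Proof. by rewrite cmpE op_id_r. Qed.

Definition dual_id : dual_car 1 0 := (op_id P, 0).

Fact dual_id_l n j (h : composable 0 1 n n 0 j j) y : dual_comp h dual_id y = y.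
Proof.
case: y => y1 y2; rewrite /dual_comp /= cmp0l add0r sgE /= !cmp_id_l //.
by comp_lia.
Qed.
Fact dual_id_r k m i (h : composable k m 1 m i 0 i) x : dual_comp h x dual_id = x.
Proof.
case: x => x1 x2; rewrite /dual_comp /= cmp0r mul0rz addr0 !cmp_id_r //.
by comp_lia.
Qed.

Fact dual_seq k k' m n p q r s (i j l a b c : int)
    (h1 : composable k m n q i j a) (h2 : composable (k + k') q p s a l c)
    (h3 : composable k' n p r j l b) (h4 : composable k m r s i b c) x y z :
    dual_comp h2 (dual_comp h1 x y) z = dual_comp h4 x (dual_comp h3 y z).
Proof.
case: x y z => [x1 x2] [y1 y2] [z1 z2]; congr pair => /=.
  by apply: cmp_seq.
rewrite !cmpDl !cmpDr !cmpSl !cmpSr !sgD.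
have eq0: absz a = absz (i + j) by move: h1 => /and3P[_ _ /eqP ->].
rewrite -!addrA; congr (_ + _); first by apply: cmp_seq => //; comp_lia.
congr (_ + _); first by congr (_ *~ _); apply: cmp_seq => //; comp_lia.
rewrite (@cmp_seq _ _ _ _ _ _ _ r _ _ _ _ _ (b+1)) //; try comp_lia.
by rewrite eq0 !sgE odd_absD; do 2![case: odd]; rewrite ?opprK.
Qed.

Fact dual_par k k' m n p q r s (i j l a b c : int) : (k < k')%N ->
    forall (h1 : composable k m n q i j a)
      (h2 : composable (k' + n).-1 q p s a l c)
      (h3 : composable k' m p r i l b) (h4 : composable k r n s b j c) x y z,
    dual_comp h4 (dual_comp h3 x z) y
      = dual_comp h2 (dual_comp h1 x y) z *~ (-1) ^+ absz (j * l).
Proof.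
move=> kk h1 h2 h3 h4 [x1 x2] [y1 y2] [z1 z2].
have ->: forall (u : dual_car s c) e, u *~ (-1)^+e = (u.1 *~ (-1)^+e, u.2 *~ (-1)^+e).
  by move=> [u v] e; rewrite !sgE; case: odd.
congr pair => /=.
  by apply: cmp_par.
rewrite !cmpDl !cmpSl !sgD.
rewrite (@cmp_par P k k' m n p q r s (i+1) j l (a+1) (b+1) (c+1)) //; try comp_lia.
rewrite (@cmp_par P k k' m n p q r s i j (l+1) a (b+1) (c+1)) //; try comp_lia.
rewrite (@cmp_par P k k' m n p q r s i (j+1) l (a+1) b (c+1)) //; try comp_lia.
rewrite -!addrA; congr (_ + _); rewrite addrC; congr (_ + _).
  have -> : b = i + l by move: h3; rewrite /composable; lia.
  rewrite !sgE !abszM !odd_absD ?oddM ?odd_absD /=.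
  by do 3![case: odd => //=]; rewrite ?opprK.
have -> : a = i + j by move: h1; rewrite /composable; lia.
rewrite !sgE !abszM !odd_absD ?oddM ?odd_absD /=.
by do 3![case: odd => //=]; rewrite ?opprK.
Qed.

Definition dual_operad : gradedOperad :=
  GradedOperad dual_compDl dual_compDr dual_id_l dual_id_r dual_seq dual_par.

End Dual.

(* The free graded operad on a collection E of generators: formal operadic
   expressions in E, two of them being identified when they take the same value
   for every choice of values of the generators in every graded operad.  The
   universal property is given by free_lift, free_lift_gen and free_lift_uniq. *)
Section FreeOperad.
Variable E : nat -> int -> Type.

Inductive term : nat -> int -> Type :=
| Tzero n i : term n i
| Tadd n i : term n i -> term n i -> term n i
| Topp n i : term n i -> term n i
| Tid : term 1 0
| Tgen n i : E n i -> term n i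
| Tcomp k m n p i j l : composable k m n p i j l ->
    term m i -> term n j -> term p l.

Fixpoint eval (Q : gradedOperad) (q : forall n i, E n i -> Q n i) n i
    (t : term n i) : Q n i :=
  match t in term n i return Q n i with
  | Tzero _ _ => 0
  | Tadd _ _ t u => eval q t + eval q u
  | Topp _ _ t => - eval q t
  | Tid => op_id Q
  | Tgen _ _ e => q _ _ e
  | Tcomp _ _ _ _ _ _ _ h t u => op_comp h (eval q t) (eval q u)
  end.

Definition term_eq n i (t u : term n i) : bool :=
  `[< forall (Q : gradedOperad) (q : forall n i, E n i -> Q n i),
        eval q t = eval q u >].

HB.instance Definition _ n i := gen_eqMixin (term n i).
HB.instance Definition _ n i := gen_choiceMixin (term n i).

Fact term_eq_refl n i : reflexive (@term_eq n i).
Proof. by move=> t; apply/asboolP. Qed.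
Fact term_eq_sym n i : symmetric (@term_eq n i).
Proof. by move=> t u; apply/asboolP/asboolP => h Q q. Qed.
Fact term_eq_trans n i : transitive (@term_eq n i).
Proof.
by move=> t u v /asboolP h1 /asboolP h2; apply/asboolP => Q q; rewrite h1 h2.
Qed.
Canonical term_equiv n i :=
  EquivRel (@term_eq n i) (@term_eq_refl n i) (@term_eq_sym n i) (@term_eq_trans n i).

Definition free_car n i := {eq_quot (@term_equiv n i)}.
HB.instance Definition _ n i := EqQuotient.on (free_car n i).
HB.instance Definition _ n i := Choice.on (free_car n i).

Definition cls n i (t : term n i) : free_car n i := \pi_(free_car n i) t.

Definition free_eval (Q : gradedOperad) (q : forall n i, E n i -> Q n i) n i (x : free_car n i) : Q n i :=
  eval q (repr x).

Lemma free_eval_cls (Q : gradedOperad) (q : forall n i, E n i -> Q n i) n i (t : term n i) : free_eval q (cls t) = eval q t :> Q n i.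
Proof.
have : term_eq (repr (cls t)) t by apply/eqmodP; rewrite reprK.
by move/asboolP; apply.
Qed.

Lemma free_ext n i (x y : free_car n i) :
  (forall (Q : gradedOperad) (q : forall n i, E n i -> Q n i),
     free_eval q x = free_eval q y) -> x = y.
Proof.
move=> h; rewrite -[x]reprK -[y]reprK; apply/eqmodP/asboolP => Q q; exact: h.
Qed.

Definition free_zero n i := cls (Tzero n i).
Definition free_add n i (x y : free_car n i) := cls (Tadd (repr x) (repr y)).
Definition free_opp n i (x : free_car n i) := cls (Topp (repr x)).
Definition free_id : free_car 1 0 := cls Tid.
Definition free_comp k m n p i j l (h : composable k m n p i j l)
  (x : free_car m i) (y : free_car n j) : free_car p l :=
  cls (Tcomp h (repr x) (repr y)).

Lemma eval_zero (Q : gradedOperad) (q : forall n i, E n i -> Q n i) n i :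
  free_eval q (free_zero n i) = 0.
Proof. exact: free_eval_cls. Qed.
Lemma eval_add (Q : gradedOperad) (q : forall n i, E n i -> Q n i) n i (x y : free_car n i) :
  free_eval q (free_add x y) = free_eval q x + free_eval q y.
Proof. exact: free_eval_cls. Qed.
Lemma eval_opp (Q : gradedOperad) (q : forall n i, E n i -> Q n i) n i (x : free_car n i) :
  free_eval q (free_opp x) = - free_eval q x.
Proof. exact: free_eval_cls. Qed.
Lemma eval_id (Q : gradedOperad) (q : forall n i, E n i -> Q n i) :
  free_eval q free_id = op_id Q.
Proof. exact: free_eval_cls. Qed.
Lemma eval_comp (Q : gradedOperad) (q : forall n i, E n i -> Q n i)
  k m n p i j l (h : composable k m n p i j l) x y :
  free_eval q (free_comp h x y) = op_comp h (free_eval q x) (free_eval q y).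
Proof. exact: free_eval_cls. Qed.

Fact free_addA n i : associative (@free_add n i).
Proof. by move=> x y z; apply: free_ext => Q q; rewrite !eval_add addrA. Qed.
Fact free_addC n i : commutative (@free_add n i).
Proof. by move=> x y; apply: free_ext => Q q; rewrite !eval_add addrC. Qed.
Fact free_add0 n i : left_id (free_zero n i) (@free_add n i).
Proof. by move=> x; apply: free_ext => Q q; rewrite eval_add eval_zero add0r. Qed.
Fact free_addN n i : left_inverse (free_zero n i) (@free_opp n i) (@free_add n i).
Proof.
by move=> x; apply: free_ext => Q q; rewrite eval_add eval_zero eval_opp addNr.
Qed.

HB.instance Definition _ n i := GRing.isZmodule.Build (free_car n i)
  (@free_addA n i) (@free_addC n i) (@free_add0 n i) (@free_addN n i).

Lemma feval_mulz (Q : gradedOperad) (q : forall n i, E n i -> Q n i) n i (x : free_car n i) e :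
  free_eval q (x *~ (-1) ^+ e) = free_eval q x *~ (-1) ^+ e.
Proof. by rewrite !sgE; case: odd; rewrite ?eval_opp. Qed.

Fact free_compDl k m n p i j l (h : composable k m n p i j l) x x' y :
  free_comp h (x + x') y = free_comp h x y + free_comp h x' y.
Proof.
by apply: free_ext => Q q; rewrite eval_add !eval_comp eval_add op_compDl.
Qed.
Fact free_compDr k m n p i j l (h : composable k m n p i j l) x y y' :
  free_comp h x (y + y') = free_comp h x y + free_comp h x y'.
Proof.
by apply: free_ext => Q q; rewrite eval_add !eval_comp eval_add op_compDr.
Qed.
Fact free_id_l n j (h : composable 0 1 n n 0 j j) y : free_comp h free_id y = y.
Proof. by apply: free_ext => Q q; rewrite eval_comp eval_id op_id_l. Qed.
Fact free_id_r k m i (h : composable k m 1 m i 0 i) x : free_comp h x free_id = x.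
Proof. by apply: free_ext => Q q; rewrite eval_comp eval_id op_id_r. Qed.
Fact free_seq k k' m n p q r s (i j l a b c : int)
    (h1 : composable k m n q i j a) (h2 : composable (k + k') q p s a l c)
    (h3 : composable k' n p r j l b) (h4 : composable k m r s i b c) x y z :
    free_comp h2 (free_comp h1 x y) z = free_comp h4 x (free_comp h3 y z).
Proof.
by apply: free_ext => Q f; rewrite !eval_comp; apply: op_seq.
Qed.
Fact free_par k k' m n p q r s (i j l a b c : int) : (k < k')%N ->
    forall (h1 : composable k m n q i j a)
      (h2 : composable (k' + n).-1 q p s a l c)
      (h3 : composable k' m p r i l b) (h4 : composable k r n s b j c) x y z,
    free_comp h4 (free_comp h3 x z) y
      = free_comp h2 (free_comp h1 x y) z *~ (-1) ^+ absz (j * l).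
Proof.
move=> kk h1 h2 h3 h4 x y z; apply: free_ext => Q f.
by rewrite feval_mulz !eval_comp; apply: op_par.
Qed.

Definition free_operad : gradedOperad :=
  GradedOperad free_compDl free_compDr free_id_l free_id_r free_seq free_par.

Definition free_gen n i (e : E n i) : free_operad n i := cls (Tgen e).

Definition free_lift (Q : gradedOperad) (q : forall n i, E n i -> Q n i) : gradedMorphism free_operad Q :=
  @GradedMorphism free_operad Q (@free_eval Q q) (@eval_add Q q) (@eval_id Q q) (@eval_comp Q q).

Lemma free_lift_gen (Q : gradedOperad) (q : forall n i, E n i -> Q n i) n i (e : E n i) :
  free_lift q _ _ (free_gen e) = q _ _ e.
Proof. exact: free_eval_cls. Qed.

Lemma cls_zero n i : cls (Tzero n i) = 0 :> free_operad n i.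
Proof. by []. Qed.
Lemma cls_add n i (t u : term n i) : cls (Tadd t u) = cls t + cls u :> free_operad n i.
Proof.
by apply: free_ext => Q q; rewrite eval_add !free_eval_cls.
Qed.
Lemma cls_opp n i (t : term n i) : cls (Topp t) = - cls t :> free_operad n i.
Proof. by apply: free_ext => Q q; rewrite eval_opp !free_eval_cls. Qed.
Lemma cls_comp k m n p i j l (h : composable k m n p i j l) t u :
  cls (Tcomp h t u) = op_comp h (cls t : free_operad m i) (cls u : free_operad n j).
Proof. by apply: free_ext => Q q; rewrite eval_comp !free_eval_cls. Qed.

Lemma free_ind (A : forall n i, free_operad n i -> Prop) :
  (forall n i, A n i 0) ->
  (forall n i x y, A n i x -> A n i y -> A n i (x + y)) ->
  (forall n i x, A n i x -> A n i (- x)) ->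
  A _ _ (op_id free_operad) ->
  (forall n i (e : E n i), A n i (free_gen e)) ->
  (forall k m n p i j l (h : composable k m n p i j l) x y,
     A m i x -> A n j y -> A p l (op_comp h x y)) ->
  forall n i x, A n i x.
Proof.
move=> A0 AD AN A1 Ag Ac n i x; rewrite -[x]reprK -/(cls _).
elim: (repr x) => //.
- by move=> *; rewrite cls_add; apply: AD.
- by move=> *; rewrite cls_opp; apply: AN.
- by move=> *; rewrite cls_comp; apply: Ac.
Qed.

Lemma free_lift_uniq Q (f g : gradedMorphism free_operad Q) :
  (forall n i (e : E n i), f _ _ (free_gen e) = g _ _ (free_gen e)) ->
  forall n i x, f n i x = g n i x.
Proof.
move=> fg; have gmN (h : gradedMorphism free_operad Q) n i x : h n i (- x) = - h n i x.
  by apply: (@addrI _ (h n i x)); rewrite -gm_add !subrr gm0.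
apply: free_ind => [n i|n i x y hx hy|n i x hx|||].
- by rewrite !gm0.
- by rewrite !gm_add hx hy.
- by rewrite !gmN hx.
- by rewrite !gm_id.
- exact: fg.
- by move=> *; rewrite !gm_comp; congr op_comp.
Qed.

(* The derivation extending delta : E -> free_operad, by the universal property
   applied to e |-> (e, delta e) in the dual numbers. *)
Variable delta : forall n i, E n i -> free_operad n (i + 1).

Definition dual_gen n i (e : E n i) : dual_operad free_operad n i := (free_gen e, delta e).
Definition free_d n i (x : free_operad n i) : free_operad n (i + 1) :=
  (free_lift dual_gen n i x).2.

Lemma free_lift_dual1 n i (x : free_operad n i) : (free_lift dual_gen n i x).1 = x.
Proof.
move: n i x; apply: free_ind => [n i|n i x y hx hy|n i x hx|||].
- by rewrite gm0.
- by rewrite gm_add /= hx hy.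
- have -> : free_lift dual_gen n i (- x) = - free_lift dual_gen n i x.
    by apply: (@addrI _ (free_lift dual_gen n i x)); rewrite -gm_add !subrr gm0.
  by rewrite /= hx.
- by rewrite gm_id.
- by move=> n i e; rewrite free_lift_gen.
- by move=> k m n p i j l h x y hx hy; rewrite gm_comp /= hx hy cmpE.
Qed.

Lemma free_d_gen n i (e : E n i) : free_d (free_gen e) = delta e.
Proof. by rewrite /free_d free_lift_gen. Qed.

Lemma free_dD n i (x y : free_operad n i) : free_d (x + y) = free_d x + free_d y.
Proof. by rewrite /free_d gm_add. Qed.

Lemma free_leibniz k m n p i j l (h : composable k m n p i j l)
    (hl : composable k m n p (i + 1) j (l + 1))
    (hr : composable k m n p i (j + 1) (l + 1)) (x : free_operad m i) (y : free_operad n j) :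
  free_d (op_comp h x y)
    = op_comp hl (free_d x) y + op_comp hr x (free_d y) *~ (-1) ^+ absz i.
Proof.
rewrite /free_d gm_comp /= !free_lift_dual1 (cmpE hl) (cmpE hr) //.
Qed.

Lemma free_d_id : free_d (op_id free_operad) = 0.
Proof. by rewrite /free_d gm_id. Qed.

Lemma free_d0 n i : free_d (0 : free_operad n i) = 0.
Proof. by rewrite /free_d gm0. Qed.

Lemma free_dN n i (x : free_operad n i) : free_d (- x) = - free_d x.
Proof. by apply: (@addrI _ (free_d x)); rewrite -free_dD !subrr free_d0. Qed.

Lemma free_dS n i (x : free_operad n i) e : free_d (x *~ (-1) ^+ e) = free_d x *~ (-1) ^+ e.
Proof. by rewrite !sgE; case: odd; rewrite ?free_dN. Qed.

Lemma free_d_sum (I : Type) (s : seq I) (A : pred I) n i (F : I -> free_operad n i) :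
  free_d (\sum_(t <- s | A t) F t) = \sum_(t <- s | A t) free_d (F t).
Proof.
elim/big_rec2: _ => [|t u v _ <-]; first exact: free_d0.
by rewrite free_dD.
Qed.

Lemma free_d_cmp k m n p i j l (x : free_operad m i) (y : free_operad n j) :
  free_d (cmp k p l x y)
   = cmp k p (l + 1) (free_d x) y + cmp k p (l + 1) x (free_d y) *~ (-1) ^+ absz i.
Proof.
case h : (composable k m n p i j l).
  have hl : composable k m n p (i + 1) j (l + 1) by comp_lia.
  have hr : composable k m n p i (j + 1) (l + 1) by comp_lia.
  by rewrite (cmpE h) (free_leibniz h hl hr) (cmpE hl) (cmpE hr).
by rewrite !cmp_bad ?free_d0 ?mul0rz ?addr0 //; comp_lia.
Qed.

Lemma free_dd : (forall n i (e : E n i), free_d (delta e) = 0) ->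
  forall n i (x : free_operad n i), free_d (free_d x) = 0.
Proof.
move=> dd; apply: free_ind => [n i|n i x y hx hy|n i x hx|||].
- by rewrite !free_d0.
- by rewrite !free_dD hx hy addr0.
- by rewrite !free_dN hx oppr0.
- by rewrite free_d_id free_d0.
- by move=> n i e; rewrite free_d_gen dd.
- move=> k m n p i j l h x y hx hy.
  rewrite -cmpE !free_d_cmp free_dD free_dS !free_d_cmp hx hy cmp0l cmp0r.
  rewrite mul0rz add0r addr0 !sgE odd_absD addbT.
  by case: odd => /=; rewrite ?subrr ?addNr.
Qed.

Definition quasi_free (dd : forall n i (e : E n i), free_d (delta e) = 0) : dgOperad :=
  DgOperad free_dD (free_dd dd) free_leibniz.

End FreeOperad.

(* One generator in each arity n >= 2, of degree 2 - n. *)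
Definition Ainf_gen (n : nat) (i : int) : Type := (2 <= n)%N && (i == 2 - n%:Z).

(* The generator m_n; by convention m_n = 0 for n < 2. *)
Definition Ainf_m (n : nat) : free_operad Ainf_gen n (2 - n%:Z) :=
  if (2 <= n)%N && (2 - n%:Z == 2 - n%:Z) =P true is ReflectT e
  then @free_gen Ainf_gen n (2 - n%:Z) e else 0.

Definition Ainf_delta n i (e : Ainf_gen n i) : free_operad Ainf_gen n (i + 1) :=
  - \sum_(i1 < n) \sum_(i2 < n | (2 <= i2)%N)
    \sum_(i3 < n | (i1 + i2 + i3 == n)%N)
      cmp i1 n (i + 1) (Ainf_m (i1 + 1 + i3)) (Ainf_m i2)
        *~ (-1) ^+ (i1 + i2 * i3).

Section AinfDD.
Local Notation mu := Ainf_m.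
Local Notation d := (free_d Ainf_delta).

Lemma sum_bij (V : zmodType) (I J : finType) (P : pred I) (Q : pred J)
   (F : I -> V) (G : J -> V) (h : I -> J) (h' : J -> I) :
  (forall i, P i -> Q (h i) /\ h' (h i) = i) ->
  (forall j, Q j -> P (h' j) /\ h (h' j) = j) ->
  (forall i, P i -> F i = G (h i)) ->
  \sum_(i | P i) F i = \sum_(j | Q j) G j.
Proof.
move=> H1 H2 H3; rewrite (reindex_onto h h'); last first.
  by move=> j /H2[].
apply: eq_big => [i|i /H3 //].
apply/idP/andP => [Pi|[Qi /eqP e]]; last by have [] := H2 _ Qi; rewrite e.
by have [-> ->] := H1 _ Pi.
Qed.

Definition P3 N n (x : 'I_N * 'I_N * 'I_N) :=
  [&& (x.1.1 < n)%N, (x.1.2 < n)%N, (x.2 < n)%N, (2 <= x.1.2)%N & (x.1.1 + x.1.2 + x.2 == n)%N].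

Lemma sum3_widen (V : zmodType) N n (F : nat -> nat -> nat -> V) : (n <= N)%N ->
  \sum_(i1 < n) \sum_(i2 < n | (2 <= i2)%N)
    \sum_(i3 < n | (i1 + i2 + i3 == n)%N) F i1 i2 i3 =
  \sum_(x : 'I_N * 'I_N * 'I_N | P3 n x) F x.1.1 x.1.2 x.2.
Proof.
move=> nN.
rewrite (big_ord_widen _ (fun i1 => \sum_(i2 < n | (2 <= i2)%N)
    \sum_(i3 < n | (i1 + i2 + i3 == n)%N) F i1 i2 i3) nN).
under eq_bigr => i1 _.
  rewrite (big_ord_widen_cond _ _ (fun i2 =>
    \sum_(i3 < n | (i1 + i2 + i3 == n)%N) F i1 i2 i3) nN).
  under eq_bigr => i2 _ do
    rewrite (big_ord_widen_cond _ (fun i3 => (i1 + i2 + i3 == n)%N) (fun i3 => F i1 i2 i3) nN).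
  over.
rewrite pair_big_dep /= pair_big_dep /=; apply: eq_bigl => -[[i1 i2] i3] /=.
by rewrite /P3 /=; lia.
Qed.

Lemma d_mu n : d (mu n) = - \sum_(i1 < n) \sum_(i2 < n | (2 <= i2)%N)
    \sum_(i3 < n | (i1 + i2 + i3 == n)%N)
      cmp i1 n (2 - n%:Z + 1) (mu (i1 + 1 + i3)) (mu i2)
        *~ (-1) ^+ (i1 + i2 * i3).
Proof.
rewrite {1}/mu; case: eqP => [e|/negP]; first by rewrite free_d_gen.
rewrite eqxx andbT -ltnNge => n2; rewrite free_d0.
rewrite big1 ?oppr0 // => i1 _; rewrite big1 // => i2 hi2.
by case/negP: (ltn_ord i2 ); lia.
Qed.

Variable n : nat.
Local Notation l := (2 - n%:Z + 1 + 1).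
Definition fx (i1 j1 i2 j2 r a : nat) : free_operad Ainf_gen n l :=
  cmp i1 n l (cmp j1 a (2 - a%:Z + 1) (mu r) (mu j2)) (mu i2).
Definition fy (i1 j1 i2 j2 r a : nat) : free_operad Ainf_gen n l :=
  cmp i1 n l (mu a) (cmp j1 i2 (2 - i2%:Z + 1) (mu r) (mu j2)).

Lemma fx_par i1 j1 i2 j2 r a : (i1 < j1)%N -> (j1 < r)%N ->
  (r + j2 = a.+1)%N -> (a + i2 = n.+1)%N ->
  fx i1 j1 i2 j2 r a =
  fx (j1 + i2).-1 i1 j2 i2 r (r + i2).-1 *~ (-1) ^+ (i2 * j2).
Proof.
move=> h1 h2 h3 h4; rewrite /fx.
rewrite (@cmp_par _ i1 j1 r i2 j2 (r + i2).-1 a n _ _ _ (2 - ((r + i2).-1)%:Z + 1)) //; try comp_lia.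
rewrite !sgE; congr (if _ then _ else _); lia.
Qed.

Lemma fx_seq i1 j1 i2 j2 r a : (j1 <= i1)%N -> (i1 < j1 + j2)%N -> (j1 < r)%N ->
  (r + j2 = a.+1)%N -> (a + i2 = n.+1)%N ->
  fx i1 j1 i2 j2 r a = fy j1 (i1 - j1) (i2 + j2).-1 i2 j2 r.
Proof.
move=> h1 h2 h3 h4 h5; rewrite /fx /fy.
rewrite -{1}(subnKC h1).
apply: cmp_seq; comp_lia.
Qed.

Local Notation N := n.+1.
Local Notation I3 := ('I_N * 'I_N * 'I_N)%type.
Definition PX (z : I3 * I3) := P3 n z.1 && P3 (z.1.1.1 + 1 + z.1.2) z.2.
Definition PY (z : I3 * I3) := P3 n z.1 && P3 z.1.1.2 z.2.

Definition FX (z : I3 * I3) :=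
  let: ((i1,i2,i3),(j1,j2,j3)) := z in
  fx i1 j1 i2 j2 (j1 + 1 + j3) (i1 + 1 + i3)
     *~ (-1) ^+ (j1 + j2 * j3 + (i1 + i2 * i3)).
Definition FY (z : I3 * I3) :=
  let: ((i1,i2,i3),(j1,j2,j3)) := z in
  fy i1 j1 i2 j2 (j1 + 1 + j3) (i1 + 1 + i3)
     *~ (-1) ^+ (j1 + j2 * j3 + (i1 + 1 + i3) + (i1 + i2 * i3)).

Definition mk (i1 i2 i3 j1 j2 j3 : nat) : I3 * I3 :=
  ((inord i1, inord i2, inord i3),(inord j1, inord j2, inord j3)).

Lemma mk_id (i1 i2 i3 j1 j2 j3 : nat) (a1 a2 a3 b1 b2 b3 : 'I_N) :
  i1 = a1 :> nat -> i2 = a2 :> nat -> i3 = a3 :> nat -> j1 = b1 :> nat -> j2 = b2 :> nat -> j3 = b3 :> nat ->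
  mk i1 i2 i3 j1 j2 j3 = ((a1,a2,a3),(b1,b2,b3)).
Proof. by move=> -> -> -> -> -> ->; rewrite /mk !inord_val. Qed.

Definition cA (z : I3 * I3) := (z.1.1.1 < z.2.1.1)%N.
Definition cC (z : I3 * I3) := (z.2.1.1 + z.2.1.2 <= z.1.1.1)%N.

Definition hAC (z : I3 * I3) : I3 * I3 :=
  let: ((i1,i2,i3),(j1,j2,j3)) := z in
  mk (i2 + j1).-1 j2 j3 i1 i2 (j1 - i1 + j3).
Definition hCA (z : I3 * I3) : I3 * I3 :=
  let: ((i1,i2,i3),(j1,j2,j3)) := z in
  mk j1 j2 (i1 - j1 - j2 + i2 + i3) (i1 + 1 - j2) i2 i3.
Definition hBY (z : I3 * I3) : I3 * I3 :=
  let: ((i1,i2,i3),(j1,j2,j3)) := z in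
  mk j1 (i2 + j2).-1 j3 (i1 - j1) i2 (j1 + j2 - 1 - i1).
Definition hYB (z : I3 * I3) : I3 * I3 :=
  let: ((i1,i2,i3),(j1,j2,j3)) := z in
  mk (i1 + j1) j2 (j3 + i3) i1 (j1 + 1 + j3) i3.

Lemma sumAC : \sum_(z | PX z && cA z) FX z = - \sum_(z | PX z && cC z) FX z.
Proof.
rewrite -sumrN; apply: (sum_bij (h := hAC) (h' := hCA)).
- move=> [[[i1 i2] i3] [[j1 j2] j3]]; rewrite /PX /cA /cC /P3 /= => h.
  by split; [rewrite !inordK; lia|apply: (@mk_id _ _ _ _ _ _ i1 i2 i3 j1 j2 j3); rewrite !inordK; lia].
- move=> [[[i1 i2] i3] [[j1 j2] j3]]; rewrite /PX /cA /cC /P3 /= => h.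
  by split; [rewrite !inordK; lia|apply: (@mk_id _ _ _ _ _ _ i1 i2 i3 j1 j2 j3); rewrite !inordK; lia].
- move=> [[[i1 i2] i3] [[j1 j2] j3]]; rewrite /PX /cA /cC /P3 /= => h.
  rewrite !inordK; try lia.
  rewrite fx_par; try lia.
  have -> : (i1 + 1 + (j1 - i1 + j3) = j1 + 1 + j3)%N by lia.
  have -> : ((i2 + j1).-1 + 1 + j3 = (j1 + 1 + j3 + i2).-1)%N by lia.
  have -> : ((j1 + i2).-1 = (i2 + j1).-1)%N by lia.
  rewrite -mulrzA -exprD !sgE.
  set b1 := odd _; set b2 := odd _.
  suff -> : b1 = ~~ b2 by case: b2; rewrite ?opprK.
  rewrite /b1 /b2.
  have [g e1] : exists g, (nat_of_ord j1 = i1 + 1 + g)%N by exists (j1 - i1 - 1)%N; lia.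
  have -> : (nat_of_ord i3 = g + j2 + j3)%N by lia.
  rewrite e1.
  have -> : ((i2 + (i1 + 1 + g)).-1 = i2 + i1 + g)%N by lia.
  have -> : (i1 + 1 + g - i1 + j3 = 1 + g + j3)%N by lia.
  rewrite !(oddD, oddM) /=.
  by case: (odd i1); case: (odd i2); case: (odd j2); case: (odd j3); case: (odd g).
Qed.

Lemma sumBY : \sum_(z | PX z && (~~ cA z && ~~ cC z)) FX z = - \sum_(z | PY z) FY z.
Proof.
rewrite -sumrN; apply: (sum_bij (h := hBY) (h' := hYB)).
- move=> [[[i1 i2] i3] [[j1 j2] j3]]; rewrite /PX /PY /cA /cC /P3 /= => h.
  by split; [rewrite !inordK; lia|apply: (@mk_id _ _ _ _ _ _ i1 i2 i3 j1 j2 j3); rewrite !inordK; lia].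
- move=> [[[i1 i2] i3] [[j1 j2] j3]]; rewrite /PX /PY /cA /cC /P3 /= => h.
  by split; [rewrite !inordK; lia|apply: (@mk_id _ _ _ _ _ _ i1 i2 i3 j1 j2 j3); rewrite !inordK; lia].
- move=> [[[i1 i2] i3] [[j1 j2] j3]]; rewrite /PX /PY /cA /cC /P3 /= => h.
  rewrite !inordK; try lia.
  rewrite fx_seq; try lia.
  have -> : (i1 - j1 + 1 + (j1 + j2 - 1 - i1) = j2)%N by lia.
  rewrite !sgE.
  set b1 := odd _; set b2 := odd _.
  suff -> : b1 = ~~ b2 by case: b2; rewrite ?opprK.
  rewrite /b1 /b2.
  have [b e1] : exists b, (nat_of_ord i1 = j1 + b)%N by exists (i1 - j1)%N; lia.
  have [e e2] : exists e, (nat_of_ord j2 = b + 1 + e)%N by exists (j2 - b - 1)%N; lia.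
  have e3 : (nat_of_ord i3 = e + j3)%N by lia.
  rewrite e1 e2 e3.
  have -> : ((i2 + (b + 1 + e)).-1 = i2 + b + e)%N by lia.
  have -> : (j1 + b - j1 = b)%N by lia.
  have -> : (j1 + (b + 1 + e) - 1 - (j1 + b) = e)%N by lia.
  rewrite !(oddD, oddM) /=.
  by case: (odd i2); case: (odd j1); case: (odd j3); case: (odd b); case: (odd e).
Qed.

Lemma sumXY : \sum_(z | PX z) FX z + \sum_(z | PY z) FY z = 0.
Proof.
rewrite (bigID cA) /= sumAC (bigID cC (fun z => PX z && ~~ cA z)) /=.
have -> : \sum_(z | PX z && ~~ cA z && cC z) FX z = \sum_(z | PX z && cC z) FX z.
  by apply: eq_bigl => -[[[i1 i2] i3] [[j1 j2] j3]]; rewrite /PX /cA /cC /P3 /=; lia.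
have -> : \sum_(z | PX z && ~~ cA z && ~~ cC z) FX z
    = \sum_(z | PX z && (~~ cA z && ~~ cC z)) FX z.
  by apply: eq_bigl => z; rewrite andbA.
by rewrite sumBY addKr addNr.
Qed.

Lemma mulNz (V : zmodType) (x : V) e : (- x) *~ (-1) ^+ e = - (x *~ (-1) ^+ e).
Proof. by rewrite !sgE; case: odd. Qed.

Lemma sum_sg (V : zmodType) (I : Type) (s : seq I) (A : pred I) (F : I -> V) e :
  (\sum_(t <- s | A t) F t) *~ (-1) ^+ e = \sum_(t <- s | A t) F t *~ (-1) ^+ e.
Proof. by elim/big_rec2: _ => [|t u v _ <-]; rewrite ?mul0rz ?mulrzDl. Qed.

Lemma d_delta_aux :
  d (\sum_(i1 < n) \sum_(i2 < n | (2 <= i2)%N)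
    \sum_(i3 < n | (i1 + i2 + i3 == n)%N)
      cmp i1 n (2 - n%:Z + 1) (mu (i1 + 1 + i3)) (mu i2)
        *~ (-1) ^+ (i1 + i2 * i3)) = 0.
Proof.
rewrite (sum3_widen (fun i1 i2 i3 => cmp i1 n (2 - n%:Z + 1) (mu (i1 + 1 + i3)) (mu i2)
        *~ (-1) ^+ (i1 + i2 * i3)) (leqnSn n)) free_d_sum.
transitivity (- (\sum_(z | PX z) FX z + \sum_(z | PY z) FY z)); last first.
  by rewrite sumXY oppr0.
have -> : \sum_(z | PX z) FX z = \sum_(x : I3 | P3 n x)
    \sum_(y : I3 | P3 (x.1.1 + 1 + x.2) y) FX (x, y).
  by rewrite pair_big_dep /=; apply: eq_big => -[x y].
have -> : \sum_(z | PY z) FY z = \sum_(x : I3 | P3 n x)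
    \sum_(y : I3 | P3 x.1.2 y) FY (x, y).
  by rewrite pair_big_dep /=; apply: eq_big => -[x y].
rewrite -big_split -sumrN /=; apply: eq_bigr => -[[i1 i2] i3].
rewrite /P3 /= => h.
rewrite free_dS free_d_cmp !d_mu.
rewrite (@sum3_widen _ N (i1 + 1 + i3) (fun j1 j2 j3 => cmp j1 (i1 + 1 + i3)
   (2 - (i1 + 1 + i3)%N%:Z + 1) (mu (j1 + 1 + j3)) (mu j2) *~ (-1) ^+ (j1 + j2 * j3))); last lia.
rewrite (@sum3_widen _ N i2 (fun j1 j2 j3 => cmp j1 i2
   (2 - i2%:Z + 1) (mu (j1 + 1 + j3)) (mu j2) *~ (-1) ^+ (j1 + j2 * j3))); last lia.
rewrite cmpNl cmpNr cmp_suml cmp_sumr mulNz -opprD mulNz; congr (- _).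
rewrite mulrzDl !sum_sg; congr (_ + _); apply: eq_bigr => -[[j1 j2] j3] _ /=.
  by rewrite cmpSl -mulrzA -exprD.
rewrite cmpSr -!mulrzA -!exprD !sgE !oddD.
have -> : odd (absz (2 - (i1 + 1 + i3)%N%:Z)) = odd (i1 + 1 + i3)%N by lia.
by rewrite !oddD !addbA.
Qed.

End AinfDD.

Fact Ainf_dd n i (e : Ainf_gen n i) : free_d Ainf_delta (Ainf_delta e) = 0.
Proof.
have /andP[_ /eqP ei] := e; move: e; rewrite ei => e.
by rewrite free_dN (@d_delta_aux n) oppr0.
Qed.

Definition Ainf : dgOperad := quasi_free Ainf_dd.

(* The abelian group presented by the generators T and the relations u = - t for
   R t u: formal sums of generators with signs, identified when every map g on T
   such that g u = - g t whenever R t u takes the same value on them.  The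
   universal property is given by pgen_antisym, plift_gen and plift_uniq. *)
Section Presented.
Variables (T : choiceType) (R : T -> T -> Prop).

Definition antisym (M : zmodType) (g : T -> M) := forall t u, R t u -> g u = - g t.

Definition ext_sum (M : zmodType) (g : T -> M) (s : seq (bool * T)) : M :=
  \sum_(x <- s) (if x.1 then - g x.2 else g x.2).

Definition sum_eq (s s' : seq (bool * T)) : bool :=
  `[< forall (M : zmodType) (g : T -> M), antisym g -> ext_sum g s = ext_sum g s' >].

Fact sum_eq_refl : reflexive sum_eq.
Proof. by move=> s; apply/asboolP. Qed.
Fact sum_eq_sym : symmetric sum_eq.
Proof. by move=> s s'; apply/asboolP/asboolP => h M g hg; rewrite h. Qed.
Fact sum_eq_trans : transitive sum_eq.
Proof.
by move=> s s' s'' /asboolP h1 /asboolP h2; apply/asboolP => M g hg; rewrite h1 ?h2.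
Qed.
Canonical sum_equiv := EquivRel sum_eq sum_eq_refl sum_eq_sym sum_eq_trans.

Definition pgrp := {eq_quot sum_equiv}.
HB.instance Definition _ := EqQuotient.on pgrp.
HB.instance Definition _ := Choice.on pgrp.

Definition psum (s : seq (bool * T)) : pgrp := \pi_pgrp s.
Definition plift (M : zmodType) (g : T -> M) (x : pgrp) : M := ext_sum g (repr x).

Lemma plift_psum (M : zmodType) (g : T -> M) s :
  antisym g -> plift g (psum s) = ext_sum g s.
Proof.
move=> hg; have : sum_eq (repr (psum s)) s by apply/eqmodP; rewrite reprK.
by move/asboolP; apply.
Qed.

Lemma pgrp_ext (x y : pgrp) :
  (forall (M : zmodType) (g : T -> M), antisym g -> plift g x = plift g y) -> x = y.
Proof. by move=> h; rewrite -[x]reprK -[y]reprK; apply/eqmodP/asboolP => M g /h. Qed.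

Definition pzero : pgrp := psum [::].
Definition padd (x y : pgrp) : pgrp := psum (repr x ++ repr y).
Definition popp (x : pgrp) : pgrp := psum [seq (~~ z.1, z.2) | z <- repr x].

Lemma ext_sum0 (M : zmodType) (g : T -> M) : ext_sum g [::] = 0.
Proof. by rewrite /ext_sum big_nil. Qed.
Lemma ext_sumD (M : zmodType) (g : T -> M) s s' :
  ext_sum g (s ++ s') = ext_sum g s + ext_sum g s'.
Proof. by rewrite /ext_sum big_cat. Qed.
Lemma ext_sumN (M : zmodType) (g : T -> M) s :
  ext_sum g [seq (~~ z.1, z.2) | z <- s] = - ext_sum g s.
Proof.
rewrite /ext_sum big_map -sumrN; apply: eq_bigr => -[[] t] _ //=.
by rewrite opprK.
Qed.

Lemma plift0 (M : zmodType) (g : T -> M) : antisym g -> plift g pzero = 0.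
Proof. by move=> hg; rewrite plift_psum // ext_sum0. Qed.
Lemma pliftD (M : zmodType) (g : T -> M) x y : antisym g ->
  plift g (padd x y) = plift g x + plift g y.
Proof. by move=> hg; rewrite plift_psum // ext_sumD. Qed.
Lemma pliftN (M : zmodType) (g : T -> M) x : antisym g ->
  plift g (popp x) = - plift g x.
Proof. by move=> hg; rewrite plift_psum // ext_sumN. Qed.

Fact paddA : associative padd.
Proof. by move=> x y z; apply: pgrp_ext => M g hg; rewrite !pliftD // addrA. Qed.
Fact paddC : commutative padd.
Proof. by move=> x y; apply: pgrp_ext => M g hg; rewrite !pliftD // addrC. Qed.
Fact padd0 : left_id pzero padd.
Proof. by move=> x; apply: pgrp_ext => M g hg; rewrite pliftD // plift0 // add0r. Qed.
Fact paddN : left_inverse pzero popp padd.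
Proof.
by move=> x; apply: pgrp_ext => M g hg; rewrite pliftD // pliftN // plift0 // addNr.
Qed.

HB.instance Definition _ := GRing.isZmodule.Build pgrp paddA paddC padd0 paddN.

Definition pgen (t : T) : pgrp := psum [:: (false, t)].

Lemma plift_gen (M : zmodType) (g : T -> M) t : antisym g -> plift g (pgen t) = g t.
Proof. by move=> hg; rewrite plift_psum // /ext_sum big_seq1. Qed.

Lemma pgen_antisym : antisym pgen.
Proof.
move=> t u r; apply: pgrp_ext => M g hg.
by rewrite plift_gen // (pliftN _ hg) plift_gen // (hg _ _ r).
Qed.

Lemma pgrp_ind (A : pgrp -> Prop) : A 0 -> (forall x y, A x -> A y -> A (x + y)) ->
  (forall x, A x -> A (- x)) -> (forall t, A (pgen t)) -> forall x, A x.
Proof.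
move=> A0 AD AN Ag x; rewrite -[x]reprK -/(psum _).
elim: (repr x) => [|[b t] s IH]; first exact: A0.
have -> : psum ((b, t) :: s) = (if b then - pgen t else pgen t) + psum s.
  apply: pgrp_ext => M g hg; rewrite (pliftD _ _ hg) !plift_psum // -cat1s ext_sumD.
  congr (_ + _); case: b; rewrite ?(pliftN _ hg) plift_gen // /ext_sum big_seq1 //.
by apply: AD => //; case: b => //; apply: AN.
Qed.

Lemma plift_addg (M : zmodType) (g g' : T -> M) x :
  plift (fun t => g t + g' t) x = plift g x + plift g' x.
Proof.
rewrite /plift /ext_sum -big_split; apply: eq_bigr => -[[] t] _ //=.
by rewrite opprD.
Qed.

Lemma plift_uniq (M : zmodType) (f f' : pgrp -> M) :
  (forall x y, f (x + y) = f x + f y) -> (forall x y, f' (x + y) = f' x + f' y) ->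
  (forall t, f (pgen t) = f' (pgen t)) -> forall x, f x = f' x.
Proof.
move=> fD f'D e.
have f0 (h : pgrp -> M) : (forall x y, h (x + y) = h x + h y) -> h 0 = 0.
  by move=> hD; apply: (@addrI _ (h 0)); rewrite -hD !addr0.
have fN (h : pgrp -> M) : (forall x y, h (x + y) = h x + h y) -> forall x, h (- x) = - h x.
  by move=> hD x; apply: (@addrI _ (h x)); rewrite -hD !subrr f0.
apply: pgrp_ind => //.
- by rewrite !f0.
- by move=> x y hx hy; rewrite fD f'D hx hy.
- by move=> x hx; rewrite !fN // hx.
Qed.

End Presented.

(* Planar forests, read from left to right: Leaf r is an incoming external edge
   followed by r, and Node x c r is a vertex, whose outgoing edge carries the
   label x and above which lies the forest c, followed by r. *)
Inductive forest (L : Type) : Type :=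
| Nil
| Leaf of forest L
| Node of L & forest L & forest L.
Arguments Nil {L}.
Arguments Leaf {L} r.
Arguments Node {L} x c r.

Section ForestCount.
Variable L : Type.
Fixpoint forest_code (f : forest L) : GenTree.tree L :=
  match f with
  | Nil => GenTree.Node 0 [::]
  | Leaf r => GenTree.Node 1 [:: forest_code r]
  | Node x c r => GenTree.Node 2 [:: GenTree.Leaf x; forest_code c; forest_code r]
  end.
Fixpoint forest_decode (t : GenTree.tree L) : option (forest L) :=
  match t with
  | GenTree.Node 0 [::] => Some Nil
  | GenTree.Node 1 [:: r] => omap Leaf (forest_decode r)
  | GenTree.Node 2 [:: GenTree.Leaf x; c; r] =>
      if forest_decode c is Some c' then omap (Node x c') (forest_decode r) else None
  | _ => None
  end.
Lemma forest_codeK : pcancel forest_code forest_decode.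
Proof. by elim=> [|r /= ->|x c /= -> r /= ->]. Qed.
End ForestCount.

HB.instance Definition _ (L : eqType) := Equality.copy (forest L) (pcan_type (@forest_codeK L)).
HB.instance Definition _ (L : choiceType) := Choice.copy (forest L) (pcan_type (@forest_codeK L)).
HB.instance Definition _ (L : countType) := Countable.copy (forest L) (pcan_type (@forest_codeK L)).

Section Forest.
Variable L : Type.
Implicit Types f g h : forest L.

Fixpoint leaves f : nat :=
  match f with Nil => 0 | Leaf r => (leaves r).+1 | Node _ c r => leaves c + leaves r end.
Fixpoint width f : nat :=
  match f with Nil => 0 | Leaf r => (width r).+1 | Node _ _ r => (width r).+1 end.
Fixpoint labels f : seq L :=
  match f with Nil => [::] | Leaf r => labels r | Node x c r => x :: labels c ++ labels r end.
Fixpoint all_vertices (p : pred nat) f : bool :=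
  match f with
  | Nil => true
  | Leaf r => all_vertices p r
  | Node _ c r => [&& p (width c), all_vertices p c & all_vertices p r]
  end.
Fixpoint fcat f g : forest L :=
  match f with Nil => g | Leaf r => Leaf (fcat r g) | Node x c r => Node x c (fcat r g) end.
(* Replaces the leaf of index k of f, if any, by g. *)
Fixpoint graft (k : nat) f g : forest L :=
  match f with
  | Nil => Nil
  | Leaf r => if k is k'.+1 then Leaf (graft k' r g) else fcat g r
  | Node x c r =>
      if (k < leaves c)%N then Node x (graft k c g) r
      else Node x c (graft (k - leaves c) r g)
  end.
Fixpoint fsize f : nat :=
  match f with Nil => 0 | Leaf r => (fsize r).+1 | Node _ c r => (fsize c + fsize r).+1 end.

Lemma leaves_fcat f g : leaves (fcat f g) = (leaves f + leaves g)%N.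
Proof. by elim: f => //= [r ->|x c _ r ->]; lia. Qed.
Lemma width_fcat f g : width (fcat f g) = (width f + width g)%N.
Proof. by elim: f => //= [r ->|x c _ r ->]; lia. Qed.
Lemma labels_fcat f g : labels (fcat f g) = labels f ++ labels g.
Proof. by elim: f => //= [x c _ r ->]; rewrite catA. Qed.
Lemma allv_fcat p f g : all_vertices p (fcat f g) = all_vertices p f && all_vertices p g.
Proof. by elim: f => //= [x c _ r ->]; rewrite !andbA. Qed.
Lemma fcatA f g h : fcat f (fcat g h) = fcat (fcat f g) h.
Proof. by elim: f => //= [r ->|x c _ r ->]. Qed.
Lemma fcat0 f : fcat f Nil = f.
Proof. by elim: f => //= [r ->|x c _ r ->]. Qed.

Lemma leaves_graft k f g : (k < leaves f)%N ->
  (leaves (graft k f g)).+1 = (leaves f + leaves g)%N.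
Proof.
elim: f k => //= [r IH [|k] h|x c IHc r IHr k h].
- by rewrite leaves_fcat; lia.
- by rewrite /= (IH k); lia.
- case: ifP => hk /=; first by have := IHc _ hk; lia.
  by have := IHr (k - leaves c)%N; lia.
Qed.
Lemma width_graft k f g : width g = 1%N -> width (graft k f g) = width f.
Proof.
move=> wg; elim: f k => //= [r IH [|k]|x c IHc r IHr k].
- by rewrite width_fcat wg.
- by rewrite /= IH.
- by case: ifP => //= _; rewrite IHr.
Qed.
Lemma labels_graft k f g : (k < leaves f)%N ->
  exists s1 s2, labels f = s1 ++ s2 /\ labels (graft k f g) = s1 ++ labels g ++ s2.
Proof.
elim: f k => //= [r IH [|k] h|x c IHc r IHr k h].
- by exists [::], (labels r); rewrite labels_fcat.
- exact: IH.
- case: ifP => hk /=.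
    have [s1 [s2 [-> ->]]] := IHc _ hk.
    by exists (x :: s1), (s2 ++ labels r); rewrite -!catA.
  have [|s1 [s2 [-> ->]]] := IHr (k - leaves c)%N; first lia.
  by exists (x :: labels c ++ s1), s2; rewrite /= -!catA.
Qed.
Lemma allv_graft p k f g : width g = 1%N -> all_vertices p f -> all_vertices p g ->
  all_vertices p (graft k f g).
Proof.
move=> wg; elim: f k => //= [r IH [|k] h1 h2|x c IHc r IHr k /and3P[h1 h2 h3] h].
- by rewrite allv_fcat h2.
- exact: IH.
- by case: ifP => hk /=; rewrite ?width_graft // ?h1 ?h2 ?h3 /= ?IHc ?IHr.
Qed.

Lemma graft_fcat k f g h : graft k (fcat f g) h =
  if (k < leaves f)%N then fcat (graft k f h) g else fcat f (graft (k - leaves f) g h).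
Proof.
elim: f k => [k|r IH [|k]|x c IHc r IHr k] /=; rewrite ?subn0 //.
- by rewrite fcatA.
- by rewrite IH ltnS subSS; case: ifP.
- case: ifP => hk; first by rewrite (leq_trans hk) ?leq_addr.
  rewrite IHr subnDA.
  have -> : (k - leaves c < leaves r)%N = (k < leaves c + leaves r)%N by lia.
  by case: ifP.
Qed.

Lemma graft_seq k k' f g h : (k < leaves f)%N -> (k' < leaves g)%N ->
  graft (k + k') (graft k f g) h = graft k f (graft k' g h).
Proof.
move=> + hk'; elim: f k => //= [r IH [|k] hk|x c IHc r IHr k hk].
- by rewrite add0n graft_fcat hk'.
- by rewrite addSn /= IH.
- case: ifP => hc /=.
    have := leaves_graft g hc => e.
    by rewrite IHc // ifT //; lia.
  rewrite ifF; last lia.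
  have -> : (k + k' - leaves c = k - leaves c + k')%N by lia.
  by rewrite IHr //; lia.
Qed.

Lemma graft_par k k' f g h : (k < k')%N -> (k' < leaves f)%N ->
  graft k (graft k' f h) g = graft (k' + leaves g).-1 (graft k f g) h.
Proof.
elim: f k k' => // [r IH [|k] [|k'] // hk hk'|x c IHc r IHr k k' /= hk hk'].
- rewrite /= graft_fcat ifF; last lia.
  by congr (fcat _ (graft _ _ _)); lia.
- have -> : ((k'.+1 + leaves g).-1 = (k' + leaves g).-1.+1)%N by lia.
  by rewrite /= IH.
- have lg := @leaves_graft.
  case: (ltnP k' (leaves c)) => hc /=.
    have kc : (k < leaves c)%N by lia.
    have := lg k' c h hc => e1; have := lg k c g kc => e2.
    rewrite kc /= ifT; last lia.
    by rewrite ifT; [rewrite IHc|lia].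
  case: ifP => kc /=.
    have := lg k c g kc => e2.
    rewrite ifF; last lia.
    by congr (Node _ _ (graft _ _ _)); lia.
  rewrite ifF; last lia.
  rewrite IHr; try lia.
  by congr (Node _ _ (graft _ _ _)); lia.
Qed.

End Forest.

Fixpoint fmap (L L' : Type) (phi : L -> L') (f : forest L) : forest L' :=
  match f with
  | Nil => Nil
  | Leaf r => Leaf (fmap phi r)
  | Node x c r => Node (phi x) (fmap phi c) (fmap phi r)
  end.

Section Fmap.
Variables (L L' : Type) (phi : L -> L').
Lemma leaves_fmap f : leaves (fmap phi f) = leaves f.
Proof. by elim: f => //= [r ->|x c -> r ->]. Qed.
Lemma width_fmap f : width (fmap phi f) = width f.
Proof. by elim: f => //= [r ->|x c _ r ->]. Qed.
Lemma allv_fmap p f : all_vertices p (fmap phi f) = all_vertices p f.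
Proof. by elim: f => //= [x c -> r ->]; rewrite width_fmap. Qed.
Lemma labels_fmap f : labels (fmap phi f) = map phi (labels f).
Proof. by elim: f => //= [x c -> r ->]; rewrite map_cat. Qed.
Lemma fmap_fcat f g : fmap phi (fcat f g) = fcat (fmap phi f) (fmap phi g).
Proof. by elim: f => //= [r ->|x c _ r ->]. Qed.
Lemma fmap_graft k f g : fmap phi (graft k f g) = graft k (fmap phi f) (fmap phi g).
Proof.
elim: f k => //= [r IH [|k]|x c IHc r IHr k] /=; first by rewrite fmap_fcat.
  by rewrite IH.
by rewrite leaves_fmap; case: ifP => _ /=; rewrite ?IHc ?IHr.
Qed.
End Fmap.

Lemma fmap_comp (L L' L'' : Type) (phi : L' -> L'') (psi : L -> L') f :
  fmap phi (fmap psi f) = fmap (phi \o psi) f.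
Proof. by elim: f => //= [r ->|x c -> r ->]. Qed.

Lemma eq_fmap (L : eqType) (L' : Type) (phi psi : L -> L') (f : forest L) :
  {in labels f, phi =1 psi} -> fmap phi f = fmap psi f.
Proof.
elim: f => //= [r IH h|x c IHc r IHr h]; first by rewrite IH.
rewrite IHc ?IHr ?h ?mem_head // => y hy; apply: h; rewrite inE mem_cat hy ?orbT //.
Qed.

Lemma fmap_id (L : eqType) (phi : L -> L) (f : forest L) :
  {in labels f, phi =1 id} -> fmap phi f = f.
Proof.
by move/eq_fmap ->; elim: f => //= [r ->|x c -> r ->].
Qed.

(* Broken ribbon trees with an ordering e_1, ..., e_i of their finite internal
   edges: the label Some j stands for the finite edge e_(j+1), and None for a
   broken edge.  The outgoing external edge of the tree also carries None, so
   that grafting a tree creates a broken edge.  The tree Leaf Nil without vertex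
   is the operadic unit. *)
Definition otree := forest (option nat).
Implicit Types (u v w : otree).

(* The labels of the finite edges of u. *)
Definition fin u : seq nat := pmap id (labels u).
Definition nfin u : nat := size (fin u).
Definition relab (phi : nat -> nat) u : otree := fmap (omap phi) u.

Definition rooted u : bool :=
  match u with Leaf Nil => true | Node None _ Nil => true | _ => false end.
Definition stable (L : Type) (f : forest L) := all_vertices (leq 2) f.
Definition well_labelled u := perm_eq (fin u) (iota 0 (nfin u)).

Definition valid (n : nat) (i : int) u : bool :=
  [&& rooted u, stable u, well_labelled u, leaves u == n & i == - (nfin u)%:Z].

(* coll j and brk j collapse and break the edge labelled j; then del renumbers
   the remaining edges, so that e_1, ..., e_i becomes the list with e_(j+1)
   omitted. *)
Fixpoint coll (j : nat) u : otree :=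
  match u with
  | Nil => Nil
  | Leaf r => Leaf (coll j r)
  | Node x c r => if x == Some j then fcat (coll j c) (coll j r)
                  else Node x (coll j c) (coll j r)
  end.
Definition brk (j : nat) u : otree := fmap (fun x => if x == Some j then None else x) u.
Definition raw (c : bool) j u := if c then coll j u else brk j u.
Definition del (c : bool) j u := relab (unbump j) (raw c j u).
(* The ordering of the grafted tree is that of u followed by that of v. *)
Definition ocomp k u v : otree := graft k u (relab (addn (nfin u)) v).

(* The relation (t, - omega) = - (t, omega) is imposed for exchanges of two
   consecutive edges in the ordering, which generate all permutations. *)
Definition swp (j x : nat) : nat := if x == j then j.+1 else if x == j.+1 then j else x.

Definition obt n i := {u : otree | valid n i u}.
Definition swapR n i (s t : obt n i) : Prop :=
  exists2 j, (j.+1 < nfin (val s))%N & val t = relab (swp j) (val s).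

Definition OB n i : zmodType := pgrp (@swapR n i).
(* The class of u, extended by 0 to the u which are not generators of arity n
   and degree i.  This extension is never used with such a u below: see
   valid_ocomp and valid_del. *)
Definition ogen n i u : OB n i := if insub u is Some t then pgen (@swapR n i) t else 0.

Lemma fin_relab phi u : fin (relab phi u) = map phi (fin u).
Proof.
rewrite /fin /relab labels_fmap; elim: (labels u) => //= -[x|] s //= ->//.
Qed.
Lemma nfin_relab phi u : nfin (relab phi u) = nfin u.
Proof. by rewrite /nfin fin_relab size_map. Qed.
Lemma leaves_relab phi u : leaves (relab phi u) = leaves u.
Proof. exact: leaves_fmap. Qed.
Lemma stable_relab phi u : stable (relab phi u) = stable u.
Proof. exact: allv_fmap. Qed.
Lemma rooted_relab phi u : rooted (relab phi u) = rooted u.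
Proof. by case: u => // [[]|[x|] c []]. Qed.
Lemma relab_comp phi psi u : relab phi (relab psi u) = relab (phi \o psi) u.
Proof. by rewrite /relab fmap_comp; apply: eq_fmap => -[]. Qed.
Lemma mem_fin u x : (x \in fin u) = (Some x \in labels u).
Proof. by rewrite /fin mem_pmap map_id. Qed.
Lemma eq_relab phi psi u : {in fin u, phi =1 psi} -> relab phi u = relab psi u.
Proof.
by move=> h; apply: eq_fmap => -[x|] //= hx; rewrite h // mem_fin.
Qed.
Lemma relab_id phi u : {in fin u, phi =1 id} -> relab phi u = u.
Proof.
by move=> h; apply: fmap_id => -[x|] //= hx; rewrite h // mem_fin.
Qed.
Lemma relab_graft phi k u v : relab phi (graft k u v) = graft k (relab phi u) (relab phi v).
Proof. exact: fmap_graft. Qed.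

Lemma fin_graft k u v : (k < leaves u)%N ->
  perm_eq (fin (graft k u v)) (fin u ++ fin v).
Proof.
move=> h; have [s1 [s2 [e1 e2]]] := labels_graft v h.
rewrite /fin e1 e2 !pmap_cat -catA perm_cat2l.
by rewrite perm_catC.
Qed.
Lemma nfin_graft k u v : (k < leaves u)%N -> nfin (graft k u v) = (nfin u + nfin v)%N.
Proof. by move=> h; rewrite /nfin (perm_size (fin_graft v h)) size_cat. Qed.

Lemma wlP u : well_labelled u -> forall x, (x \in fin u) = (x < nfin u)%N.
Proof. by move=> h x; rewrite (perm_mem h) mem_iota. Qed.
Lemma wl_uniq u : well_labelled u -> uniq (fin u).
Proof. by move=> h; rewrite (perm_uniq h) iota_uniq. Qed.

Lemma wl_relab phi u : well_labelled u ->
  {in gtn (nfin u) &, injective phi} -> (forall x, (x < nfin u)%N -> (phi x < nfin u)%N) ->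
  well_labelled (relab phi u).
Proof.
move=> h hi hl; rewrite /well_labelled nfin_relab fin_relab.
have un : uniq (map phi (fin u)).
  rewrite map_inj_in_uniq ?wl_uniq // => x y hx hy; apply: hi; rewrite inE -?wlP //.
apply: uniq_perm => //; first exact: iota_uniq.
have sub : {subset map phi (fin u) <= iota 0 (nfin u)}.
  by move=> x /mapP[y hy ->]; rewrite mem_iota /= add0n hl // -wlP.
have sz : (size (iota 0 (nfin u)) <= size (map phi (fin u)))%N.
  by rewrite size_iota size_map.
by have [_ e] := uniq_min_size un sub sz.
Qed.

Lemma rooted_width u : rooted u -> width u = 1%N.
Proof. by case: u => // [[]|[x|] c []]. Qed.

Lemma rooted_graft k u v : (k < leaves u)%N -> rooted u -> rooted v -> rooted (graft k u v).
Proof.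
case: u => // [[]//|[x|] c [] //] /=; last by rewrite addn0 => ->.
by case: k => //= _ _; case: v => // [[]|[x|] c []].
Qed.

Lemma valid_ocomp k m n p i j l u v : composable k m n p i j l ->
  valid m i u -> valid n j v -> valid p l (ocomp k u v).
Proof.
move=> /and3P[km /eqP mn /eqP ij] /and5P[ru su wu /eqP lu /eqP iu] /and5P[rv sv wv /eqP lv /eqP jv].
have ku : (k < leaves u)%N by rewrite lu.
have nf : nfin (ocomp k u v) = (nfin u + nfin v)%N by rewrite nfin_graft ?nfin_relab.
apply/and5P; split.
- by rewrite rooted_graft ?rooted_relab.
- rewrite /stable allv_graft // ?rooted_width ?rooted_relab //.
  by rewrite -/(stable _) stable_relab.
- rewrite /well_labelled nf (perm_trans (fin_graft _ ku)) // fin_relab iotaD.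
  rewrite perm_cat // add0n -[X in iota X]addn0 iotaDl.
  exact: perm_map.
- by have := leaves_graft (relab (addn (nfin u)) v) ku; rewrite leaves_relab lu lv mn /ocomp => -[->].
- by rewrite nf -ij iu jv; apply/eqP; lia.
Qed.

Lemma raw_leaves c j u : leaves (raw c j u) = leaves u.
Proof.
case: c; last exact: leaves_fmap.
rewrite /raw; elim: u => //= [r -> //|x c hc r hr].
by case: ifP => _; rewrite ?leaves_fcat /= hc hr.
Qed.
Lemma raw_fin c j u : fin (raw c j u) = [seq x <- fin u | x != j].
Proof.
rewrite /fin; case: c; rewrite /raw.
- elim: u => //= x c hc r hr; case: eqP => [->|xj] /=.
    by rewrite eqxx labels_fcat !pmap_cat filter_cat hc hr.
  rewrite !pmap_cat !hc !hr; case: x xj => [x|] xj /=; rewrite ?filter_cat //.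
  by case: eqP => [e|]; first by rewrite e in xj.
- rewrite labels_fmap; elim: (labels u) => //= -[x|] s //= ->.
  by case: eqP => [[->]|xj] /=; [rewrite eqxx|case: eqP => [e|//]; rewrite e in xj].
Qed.
Lemma coll_width j u : stable u -> (width u <= width (coll j u))%N /\ stable (coll j u).
Proof.
rewrite /stable; elim: u => //= x c hc r hr /and3P[wc /hc[c1 c2] /hr[r1 r2]].
by case: ifP => _ /=; rewrite ?width_fcat ?allv_fcat ?c2 ?r2; split=> //; lia.
Qed.
Lemma raw_stable c j u : stable u -> stable (raw c j u).
Proof.
case: c; first by move/(coll_width j)=> [].
by rewrite /stable allv_fmap.
Qed.
Lemma raw_rooted c j u : rooted u -> rooted (raw c j u).
Proof. by case: c; case: u => // [[]|[x|] c []]. Qed.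

Lemma raw_id c j u : j \notin fin u -> raw c j u = u.
Proof.
rewrite mem_fin; case: c; rewrite /raw.
  elim: u => //= [r IH /IH -> //|x c hc r hr].
  rewrite inE mem_cat !negb_or => /and3P[h1 /hc -> /hr ->].
  by rewrite eq_sym (negbTE h1).
by move=> h; apply: fmap_id => x hx; case: eqP => // e; rewrite -e hx in h.
Qed.

Lemma coll_fcat j u v : coll j (fcat u v) = fcat (coll j u) (coll j v).
Proof.
elim: u => //= [r ->|x c _ r ->] //.
by case: ifP => _ //=; rewrite fcatA.
Qed.
Lemma raw_graft c j k u v : raw c j (graft k u v) = graft k (raw c j u) (raw c j v).
Proof.
case: c; last exact: fmap_graft.
rewrite /raw; elim: u k => //= [r IH [|k]|x c hc r hr k].
- by rewrite coll_fcat.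
- by rewrite /= IH.
- have lc : leaves (coll j c) = leaves c by exact: (raw_leaves true).
  by case: ifP => hk /=; case: ifP => _; rewrite ?graft_fcat /= lc hk ?hc ?hr.
Qed.

Lemma coll_relab phi j u : (forall x, x \in fin u -> phi x = phi j -> x = j) ->
  coll (phi j) (relab phi u) = relab phi (coll j u).
Proof.
move=> h; have {h} : forall x, Some x \in labels u -> phi x = phi j -> x = j.
  by move=> x; rewrite -mem_fin; exact: h.
rewrite /relab; elim: u => //= [r IH h|x c hc r hr h]; first by rewrite IH.
rewrite hc ?hr; first last.
- by move=> y hy; apply: h; rewrite inE mem_cat hy orbT.
- by move=> y hy; apply: h; rewrite inE mem_cat hy !orbT.
case: x h => [x|] //= h; rewrite -!/(Some _ == Some _).
have -> : (Some (phi x) == Some (phi j)) = (Some x == Some j).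
  apply/eqP/eqP => [[e]|[->] //]; congr Some; apply: h => //; exact: mem_head.
by case: ifP => //=; rewrite fmap_fcat.
Qed.
Lemma raw_relab c phi j u : (forall x, x \in fin u -> phi x = phi j -> x = j) ->
  raw c (phi j) (relab phi u) = relab phi (raw c j u).
Proof.
case: c => h; first exact: coll_relab.
rewrite /raw /brk /relab !fmap_comp; apply: eq_fmap => -[x|] //=.
rewrite -mem_fin => /h e.
case: eqP => [[/e ->]|xj]; first by rewrite eqxx.
by case: eqP => // -[e']; rewrite e' in xj.
Qed.

Lemma raw_comm c c' j j' u : j != j' -> raw c j (raw c' j' u) = raw c' j' (raw c j u).
Proof.
have cb i i' (v : otree) : i != i' -> coll i (brk i' v) = brk i' (coll i v).
  move=> ii; rewrite /brk; elim: v => //= [r ->|x d -> r ->] //.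
  have [->|xi] := eqVneq x (Some i').
    have /negbTE -> : Some i' != Some i by apply: contraNneq ii => -[->].
    by rewrite /= eqxx.
  by case: ifP => //= xi'; rewrite ?fmap_fcat ?(negbTE xi).
case: c; case: c' => jj; rewrite /raw.
- elim: u => //= [r ->|x d IHd r IHr] //.
  have [->|xi] := eqVneq x (Some j).
    have /negbTE e : Some j != Some j' by apply: contraNneq jj => -[->].
    by rewrite e /= eqxx coll_fcat IHd IHr.
  have [e|xi'] := eqVneq x (Some j').
    by rewrite coll_fcat IHd IHr /= e eqxx.
  by rewrite /= (negbTE xi) (negbTE xi') IHd IHr.
- exact: cb.
- by rewrite cb // eq_sym.
- rewrite /brk !fmap_comp; apply: eq_fmap => x _ /=.
  have [->|xi] := eqVneq x (Some j); last by case: (eqVneq x (Some j')) => //= _; rewrite (negbTE xi).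
  have /negbTE e : Some j != Some j' by apply: contraNneq jj => -[->].
  by rewrite e eqxx.
Qed.

Lemma nfin_del c j u : well_labelled u -> (j < nfin u)%N -> nfin (del c j u) = (nfin u).-1.
Proof.
move=> wu ju; rewrite nfin_relab /nfin raw_fin -(rem_filter _ (wl_uniq wu)).
by rewrite size_rem // wlP.
Qed.

Lemma wl_del c j u : well_labelled u -> (j < nfin u)%N -> well_labelled (del c j u).
Proof.
move=> wu ju; rewrite /well_labelled nfin_del // fin_relab raw_fin.
apply: uniq_perm; rewrite ?iota_uniq //.
  rewrite map_inj_in_uniq ?filter_uniq ?wl_uniq // => x y.
  by rewrite !mem_filter => /andP[xj _] /andP[yj _]; rewrite /unbump; lia.
move=> x; rewrite mem_iota add0n /=; apply/mapP/idP => [[y]|hx].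
  by rewrite mem_filter wlP // => /andP[yj hy] ->; rewrite /unbump; lia.
exists (bump j x); last by rewrite bumpK.
by rewrite mem_filter wlP // /bump; lia.
Qed.

Lemma valid_del c j n i u : valid n i u -> (j < nfin u)%N -> valid n (i + 1) (del c j u).
Proof.
move=> /and5P[ru su wu lu /eqP iu] ju; apply/and5P; split.
- by rewrite rooted_relab raw_rooted.
- by rewrite stable_relab raw_stable.
- exact: wl_del.
- by rewrite leaves_relab raw_leaves.
- by rewrite nfin_del // iu; apply/eqP; lia.
Qed.

Ltac iflia := move=> /=; intros; repeat match goal with |- context [if ?b then _ else _] =>
  lazymatch b with context [if _ then _ else _] => fail | _ => case: (boolP b) => ? end end; lia.

Lemma plift_oppg (T : choiceType) (R : T -> T -> Prop) (M : zmodType) (g : T -> M) (x : pgrp R) :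
  plift (fun t => - g t) x = - plift g x.
Proof.
rewrite /plift /ext_sum -sumrN; apply: eq_bigr => -[[] t] _ //=.
Qed.
Lemma eq_plift (T : choiceType) (R : T -> T -> Prop) (M : zmodType) (g g' : T -> M) (x : pgrp R) :
  g =1 g' -> plift g x = plift g' x.
Proof. by move=> e; congr plift; apply: funext. Qed.

Lemma ogenE n i u (h : valid n i u) : ogen n i u = pgen (@swapR n i) (Sub u h).
Proof. by rewrite /ogen insubT. Qed.
Lemma ogen_val n i (s : obt n i) : ogen n i (val s) = pgen (@swapR n i) s.
Proof. by rewrite /ogen valK. Qed.
Lemma ogen0 n i u : ~~ valid n i u -> ogen n i u = 0.
Proof. by move=> h; rewrite /ogen insubN. Qed.

Lemma swpK j : involutive (swp j).
Proof. by move=> x; rewrite /swp; iflia. Qed.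

Lemma valid_relab_swp n i u j : (j.+1 < nfin u)%N -> valid n i u ->
  valid n i (relab (swp j) u).
Proof.
move=> ju /and5P[ru su wu lu iu]; apply/and5P; split.
- by rewrite rooted_relab.
- by rewrite stable_relab.
- apply: wl_relab => // [x y _ _ /(inv_inj (@swpK j)) //|x]; rewrite /swp; iflia.
- by rewrite leaves_relab.
- by rewrite nfin_relab.
Qed.

Lemma ogen_swp n i u j : (j.+1 < nfin u)%N ->
  ogen n i (relab (swp j) u) = - ogen n i u.
Proof.
move=> ju; case: (boolP (valid n i u)) => hu; last first.
  rewrite !ogen0 ?oppr0 //; apply: contra hu => hu.
  have := valid_relab_swp (j := j) _ hu; rewrite nfin_relab relab_comp => /(_ ju).
  by rewrite relab_id // => x _ /=; rewrite swpK.
rewrite (ogenE hu) (ogenE (valid_relab_swp ju hu)).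
by apply: pgen_antisym; exists j.
Qed.

Lemma OB_ind n i (A : OB n i -> Prop) : A 0 -> (forall x y, A x -> A y -> A (x + y)) ->
  (forall x, A x -> A (- x)) -> (forall u, valid n i u -> A (ogen n i u)) ->
  forall x, A x.
Proof.
move=> A0 AD AN Ag; apply: pgrp_ind => // s; rewrite -ogen_val; apply: Ag; exact: valP.
Qed.

Lemma ocomp_swpl k u v j : (k < leaves u)%N -> (j.+1 < nfin u)%N ->
  ocomp k (relab (swp j) u) v = relab (swp j) (ocomp k u v).
Proof.
move=> ku ju; rewrite /ocomp relab_graft nfin_relab relab_comp; congr graft.
by apply: eq_relab => x _ /=; rewrite /swp; iflia.
Qed.
Lemma ocomp_swpr k u v j : well_labelled u ->
  ocomp k u (relab (swp j) v) = relab (swp (nfin u + j)) (ocomp k u v).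
Proof.
move=> wu; rewrite /ocomp relab_graft !relab_comp; congr graft.
  by rewrite relab_id // => x; rewrite wlP // /swp; iflia.
by apply: eq_relab => x _ /=; rewrite /swp; iflia.
Qed.

Definition OBcomp k m n p i j l (h : composable k m n p i j l) (x : OB m i) (y : OB n j) : OB p l :=
  plift (fun s : obt m i => plift (fun t : obt n j => ogen p l (ocomp k (val s) (val t))) y) x.

Section Comp.
Variables (k m n p : nat) (i j l : int) (h : composable k m n p i j l).

Lemma leaves_valid m' i' u : valid m' i' u -> leaves u = m'.
Proof. by case/and5P => _ _ _ /eqP. Qed.
Lemma wl_valid m' i' u : valid m' i' u -> well_labelled u.
Proof. by case/and5P. Qed.
Lemma nfin_valid m' i' u : valid m' i' u -> i' = - (nfin u)%:Z.
Proof. by case/and5P => _ _ _ _ /eqP. Qed.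

Lemma comp_antir (s : obt m i) :
  antisym (@swapR n j) (fun t : obt n j => ogen p l (ocomp k (val s) (val t))).
Proof.
move=> t t' [a ha ->]; have ks : (k < leaves (val s))%N.
  by rewrite (leaves_valid (valP s)); case/and3P: h.
rewrite ocomp_swpr ?ogen_swp ?(wl_valid (valP s)) //.
by rewrite nfin_graft // nfin_relab; lia.
Qed.

Lemma comp_antil (y : OB n j) :
  antisym (@swapR m i) (fun s : obt m i => plift (fun t : obt n j => ogen p l (ocomp k (val s) (val t))) y).
Proof.
move=> s s' [a ha ->]; rewrite -plift_oppg; apply: eq_plift => t.
have ks : (k < leaves (val s))%N.
  by rewrite (leaves_valid (valP s)); case/and3P: h.
rewrite ocomp_swpl ?ogen_swp //.
by rewrite nfin_graft // nfin_relab; lia.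
Qed.

Lemma OBcomp_gen u v : valid m i u -> valid n j v ->
  OBcomp h (ogen m i u) (ogen n j v) = ogen p l (ocomp k u v).
Proof.
move=> hu hv; rewrite (ogenE hu) (ogenE hv) /OBcomp plift_gen; last exact: comp_antil.
by rewrite plift_gen; last exact: comp_antir.
Qed.

Fact OBcompDl x x' y : OBcomp h (x + x') y = OBcomp h x y + OBcomp h x' y.
Proof. exact: (pliftD _ _ (@comp_antil y)). Qed.
Fact OBcompDr x y y' : OBcomp h x (y + y') = OBcomp h x y + OBcomp h x y'.
Proof.
rewrite /OBcomp -plift_addg; apply: eq_plift => s.
exact: (pliftD _ _ (@comp_antir s)).
Qed.
Lemma OBcomp0l y : OBcomp h 0 y = 0.
Proof. by apply: (@addrI _ (OBcomp h 0 y)); rewrite -OBcompDl !addr0. Qed.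
Lemma OBcomp0r x : OBcomp h x 0 = 0.
Proof. by apply: (@addrI _ (OBcomp h x 0)); rewrite -OBcompDr !addr0. Qed.
Lemma OBcompNl x y : OBcomp h (- x) y = - OBcomp h x y.
Proof. by apply: (@addrI _ (OBcomp h x y)); rewrite -OBcompDl !subrr OBcomp0l. Qed.
Lemma OBcompNr x y : OBcomp h x (- y) = - OBcomp h x y.
Proof. by apply: (@addrI _ (OBcomp h x y)); rewrite -OBcompDr !subrr OBcomp0r. Qed.
Lemma OBcompSl x y e : OBcomp h (x *~ (-1) ^+ e) y = OBcomp h x y *~ (-1) ^+ e.
Proof. by rewrite !sgE; case: odd; rewrite ?OBcompNl. Qed.
Lemma OBcompSr x y e : OBcomp h x (y *~ (-1) ^+ e) = OBcomp h x y *~ (-1) ^+ e.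
Proof. by rewrite !sgE; case: odd; rewrite ?OBcompNr. Qed.
Lemma OBcomp_suml (I : Type) (r : seq I) (P : pred I) (F : I -> OB m i) y :
  OBcomp h (\sum_(t <- r | P t) F t) y = \sum_(t <- r | P t) OBcomp h (F t) y.
Proof. by elim/big_rec2: _ => [|t a b _ <-]; rewrite ?OBcomp0l ?OBcompDl. Qed.
Lemma OBcomp_sumr (I : Type) (r : seq I) (P : pred I) (F : I -> OB n j) x :
  OBcomp h x (\sum_(t <- r | P t) F t) = \sum_(t <- r | P t) OBcomp h x (F t).
Proof. by elim/big_rec2: _ => [|t a b _ <-]; rewrite ?OBcomp0r ?OBcompDr. Qed.

End Comp.

Definition OBid : OB 1 0 := ogen 1 0 (Leaf Nil).
Lemma valid_id : valid 1 0 (Leaf Nil).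
Proof. by []. Qed.

Fact OB_id_l n j (h : composable 0 1 n n 0 j j) y : OBcomp h OBid y = y.
Proof.
elim/OB_ind: y => [|x y hx hy|x hx|u hu].
- exact: OBcomp0r.
- by rewrite OBcompDr hx hy.
- by rewrite OBcompNr hx.
- by rewrite OBcomp_gen // /ocomp /= fcat0 relab_id.
Qed.

Lemma graft_id (L : Type) (f : forest L) k : graft k f (Leaf Nil) = f.
Proof.
elim: f k => //= [r IH [|k] //|x c hc r hr k]; first by rewrite /= IH.
by case: ifP; rewrite ?hc ?hr.
Qed.

Fact OB_id_r k m i (h : composable k m 1 m i 0 i) x : OBcomp h x OBid = x.
Proof.
elim/OB_ind: x => [|x y hx hy|x hx|u hu].
- exact: OBcomp0l.
- by rewrite OBcompDl hx hy.
- by rewrite OBcompNl hx.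
- by rewrite OBcomp_gen // /ocomp /= graft_id.
Qed.

Fact OB_seq k k' m n p q r s (i j l a b c : int)
    (h1 : composable k m n q i j a) (h2 : composable (k + k') q p s a l c)
    (h3 : composable k' n p r j l b) (h4 : composable k m r s i b c) x y z :
    OBcomp h2 (OBcomp h1 x y) z = OBcomp h4 x (OBcomp h3 y z).
Proof.
elim/OB_ind: x => [|x x' hx hx'|x hx|u hu].
- by rewrite !OBcomp0l.
- by rewrite !OBcompDl hx hx'.
- by rewrite !OBcompNl hx.
elim/OB_ind: y => [|y y' hy hy'|y hy|v hv].
- by rewrite !(OBcomp0l, OBcomp0r).
- by rewrite !(OBcompDl, OBcompDr) hy hy'.
- by rewrite !(OBcompNl, OBcompNr) hy.
elim/OB_ind: z => [|z z' hz hz'|z hz|w hw].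
- by rewrite !(OBcomp0l, OBcomp0r).
- by rewrite !(OBcompDl, OBcompDr) hz hz'.
- by rewrite !(OBcompNl, OBcompNr) hz.
rewrite (OBcomp_gen h1) // (OBcomp_gen h3) // !OBcomp_gen //; try exact: (valid_ocomp h1); try exact: (valid_ocomp h3).
have ku : (k < leaves u)%N by rewrite (leaves_valid hu); case/and3P: h1.
have kv : (k' < leaves v)%N by rewrite (leaves_valid hv); case/and3P: h3.
congr ogen; rewrite /ocomp nfin_graft // nfin_relab graft_seq ?leaves_relab //.
congr graft; rewrite relab_graft; congr graft; rewrite relab_comp.
by apply: eq_relab => t _ /=; lia.
Qed.

Definition cyc a q x := if x == a then (a + q)%N else if (a < x <= a + q)%N then x.-1 else x.
Definition blk a p q x := if (a <= x < a + p)%N then (x + q)%N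
   else if (a + p <= x < a + p + q)%N then (x - p)%N else x.

Lemma ogen_cyc n i u a q : (a + q < nfin u)%N ->
  ogen n i (relab (cyc a q) u) = ogen n i u *~ (-1) ^+ q.
Proof.
elim: q => [|q IH] hq.
  rewrite relab_id ?expr0 ?mulr1z // => x _; rewrite /cyc; iflia.
have -> : relab (cyc a q.+1) u = relab (swp (a + q)) (relab (cyc a q) u).
  by rewrite relab_comp; apply: eq_relab => x _ /=; rewrite /cyc /swp; iflia.
rewrite ogen_swp ?nfin_relab ?IH; try lia.
by rewrite !sgE /=; case: odd; rewrite /= ?opprK.
Qed.

Lemma ogen_blk n i u a p q : (a + p + q <= nfin u)%N ->
  ogen n i (relab (blk a p q) u) = ogen n i u *~ (-1) ^+ (p * q).
Proof.
elim: p u => [|p IH] u hq.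
  rewrite relab_id ?mul0n ?expr0 ?mulr1z // => x _; rewrite /blk; iflia.
have -> : relab (blk a p.+1 q) u = relab (blk a p q) (relab (cyc (a + p) q) u).
  by rewrite relab_comp; apply: eq_relab => x _ /=; rewrite /cyc /blk; iflia.
rewrite IH ?nfin_relab ?ogen_cyc; try lia.
by rewrite -mulrzA -exprD mulSn.
Qed.

Lemma OB_mulz0 n i e : (0 : OB n i) *~ e = 0.
Proof. exact: mul0rz. Qed.

Fact OB_par k k' m n p q r s (i j l a b c : int) : (k < k')%N ->
    forall (h1 : composable k m n q i j a)
      (h2 : composable (k' + n).-1 q p s a l c)
      (h3 : composable k' m p r i l b) (h4 : composable k r n s b j c) x y z,
    OBcomp h4 (OBcomp h3 x z) y
      = OBcomp h2 (OBcomp h1 x y) z *~ (-1) ^+ absz (j * l).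
Proof.
move=> kk h1 h2 h3 h4 x y z.
elim/OB_ind: x => [|x x' hx hx'|x hx|u hu].
- by rewrite !OBcomp0l mul0rz.
- by rewrite !OBcompDl hx hx' mulrzDl.
- by rewrite !OBcompNl hx mulNrz.
elim/OB_ind: y => [|y y' hy hy'|y hy|v hv].
- by rewrite !(OBcomp0l, OBcomp0r) mul0rz.
- by rewrite !(OBcompDl, OBcompDr) hy hy' mulrzDl.
- by rewrite !(OBcompNl, OBcompNr) hy mulNrz.
elim/OB_ind: z => [|z z' hz hz'|z hz|w hw].
- by rewrite !(OBcomp0l, OBcomp0r) mul0rz.
- by rewrite !(OBcompDl, OBcompDr) hz hz' mulrzDl.
- by rewrite !(OBcompNl, OBcompNr) hz mulNrz.
rewrite (OBcomp_gen h1) // (OBcomp_gen h3) // !OBcomp_gen //; try exact: (valid_ocomp h1); try exact: (valid_ocomp h3).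
have ku : (k < leaves u)%N by rewrite (leaves_valid hu); case/and3P: h1.
have ku' : (k' < leaves u)%N by rewrite (leaves_valid hu); case/and3P: h3.
have -> : ocomp k (ocomp k' u w) v
   = relab (blk (nfin u) (nfin v) (nfin w)) (ocomp (k' + n).-1 (ocomp k u v) w).
  rewrite /ocomp !nfin_graft // !nfin_relab.
  rewrite graft_par // leaves_relab (leaves_valid hv) !relab_graft.
  rewrite !relab_comp; congr (graft _ (graft _ _ _) _).
  - rewrite relab_id // => x; rewrite (wlP (wl_valid hu)) /blk; iflia.
  - by apply: eq_relab => x; rewrite (wlP (wl_valid hv)) /= /blk; iflia.
  - by apply: eq_relab => x; rewrite (wlP (wl_valid hw)) /= /blk; iflia.
rewrite ogen_blk; last first.
  rewrite !nfin_graft ?nfin_relab //.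
  have := leaves_graft (relab (addn (nfin u)) v) ku.
  rewrite /ocomp leaves_relab (leaves_valid hu) (leaves_valid hv).
  by move: h3; rewrite /composable; lia.
by rewrite (nfin_valid hv) (nfin_valid hw) mulrNN.
Qed.

Definition OBop : gradedOperad :=
  @GradedOperad OB OBid OBcomp OBcompDl OBcompDr OB_id_l OB_id_r OB_seq OB_par.

Definition collapse j u := del true j u.
Definition break j u := del false j u.

Definition odiff n i u : OB n i :=
  \sum_(j < nfin u) (ogen n i (collapse j u) - ogen n i (break j u)) *~ (-1) ^+ j.+1.

Definition OBd n i (x : OB n i) : OB n (i + 1) :=
  plift (fun s : obt n i => odiff n (i + 1) (val s)) x.

Lemma del_swp_lt c i j u : (j < i)%N -> del c j (relab (swp i) u) = relab (swp i.-1) (del c j u).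
Proof.
move=> ji; rewrite /del.
have sj : j = swp i j by rewrite /swp; iflia.
rewrite {2}sj raw_relab; last by move=> x _ /(inv_inj (@swpK i)).
rewrite !relab_comp; apply: eq_relab => x.
by rewrite raw_fin mem_filter => /andP[xj _] /=; rewrite /swp /unbump; iflia.
Qed.
Lemma del_swp_gt c i j u : (i.+1 < j)%N -> del c j (relab (swp i) u) = relab (swp i) (del c j u).
Proof.
move=> ji; rewrite /del.
have sj : j = swp i j by rewrite /swp; iflia.
rewrite {2}sj raw_relab; last by move=> x _ /(inv_inj (@swpK i)).
rewrite !relab_comp; apply: eq_relab => x.
by rewrite raw_fin mem_filter => /andP[xj _] /=; rewrite /swp /unbump; iflia.
Qed.
Lemma del_swp_eq c i u : del c i (relab (swp i) u) = del c i.+1 u.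
Proof.
rewrite /del.
have sj : i = swp i i.+1 by rewrite /swp; iflia.
rewrite {2}sj raw_relab; last by move=> x _ /(inv_inj (@swpK i)).
rewrite !relab_comp; apply: eq_relab => x.
by rewrite raw_fin mem_filter => /andP[xj _] /=; rewrite /swp /unbump; iflia.
Qed.
Lemma del_swp_eqS c i u : del c i.+1 (relab (swp i) u) = del c i u.
Proof.
rewrite /del.
have sj : i.+1 = swp i i by rewrite /swp; iflia.
rewrite {2}sj raw_relab; last by move=> x _ /(inv_inj (@swpK i)).
rewrite !relab_comp; apply: eq_relab => x.
by rewrite raw_fin mem_filter => /andP[xj _] /=; rewrite /swp /unbump; iflia.
Qed.

Lemma swp_lt i j k : (i.+1 < k)%N -> (j < k)%N -> (swp i j < k)%N.
Proof. by rewrite /swp; iflia. Qed.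

Lemma odiff_swp n i a u : well_labelled u -> (a.+1 < nfin u)%N ->
  odiff n i (relab (swp a) u) = - odiff n i u.
Proof.
move=> wu au; rewrite /odiff nfin_relab.
pose h (j : 'I_(nfin u)) : 'I_(nfin u) := Ordinal (swp_lt au (ltn_ord j)).
have hinj : injective h by move=> x y [] /(inv_inj (@swpK a)) e; apply: val_inj.
rewrite [in RHS](reindex_inj hinj) -sumrN; apply: eq_bigr => j _ /=.
rewrite /collapse /break.
have [ja|ja|ja] := ltngtP j a.
- have -> : swp a j = j by rewrite /swp; iflia.
  rewrite !del_swp_lt // !ogen_swp ?nfin_del //; try by have := ltn_ord j; lia.
  by rewrite -opprD !sgE; case: odd; rewrite ?opprK.
- have [jS|jS] := eqVneq (j : nat) a.+1.
    have -> : swp a j = a by rewrite /swp; iflia.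
    rewrite jS !del_swp_eqS !sgE /=.
    by case: odd; rewrite /= ?opprK.
  have -> : swp a j = j by rewrite /swp; iflia.
  rewrite !del_swp_gt ?ogen_swp ?nfin_del //; try by have := ltn_ord j; lia.
  by rewrite -opprD !sgE; case: odd; rewrite ?opprK.
- have -> : swp a j = a.+1 by rewrite /swp; iflia.
  rewrite ja !del_swp_eq !sgE /=.
  by case: odd; rewrite /= ?opprK.
Qed.

Lemma odiff_antisym n i :
  antisym (@swapR n i) (fun s : obt n i => odiff n (i + 1) (val s)).
Proof. by move=> s t [a ha ->]; rewrite odiff_swp // (wl_valid (valP s)). Qed.

Lemma OBd_gen n i u : valid n i u -> OBd (ogen n i u) = odiff n (i + 1) u.
Proof. by move=> hu; rewrite (ogenE hu) /OBd plift_gen //; exact: odiff_antisym. Qed.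

Fact OBdD n i (x y : OB n i) : OBd (x + y) = OBd x + OBd y.
Proof. exact: (pliftD _ _ (@odiff_antisym n i)). Qed.
Lemma OBd0 n i : OBd (0 : OB n i) = 0.
Proof. by apply: (@addrI _ (OBd (0 : OB n i))); rewrite -OBdD !addr0. Qed.
Lemma OBdN n i (x : OB n i) : OBd (- x) = - OBd x.
Proof. by apply: (@addrI _ (OBd x)); rewrite -OBdD !subrr OBd0. Qed.
Lemma OBdS n i (x : OB n i) e : OBd (x *~ (-1) ^+ e) = OBd x *~ (-1) ^+ e.
Proof. by rewrite !sgE; case: odd; rewrite ?OBdN. Qed.
Lemma OBd_sum (I : Type) (r : seq I) (P : pred I) n i (F : I -> OB n i) :
  OBd (\sum_(t <- r | P t) F t) = \sum_(t <- r | P t) OBd (F t).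
Proof. by elim/big_rec2: _ => [|t a b _ <-]; rewrite ?OBd0 ?OBdD. Qed.

Lemma del_ocompl c k j u v : well_labelled u -> (j < nfin u)%N ->
  del c j (ocomp k u v) = ocomp k (del c j u) v.
Proof.
move=> wu ju; rewrite /ocomp /del raw_graft relab_graft; congr graft.
rewrite raw_id; last by rewrite fin_relab; apply/mapP => -[x _]; lia.
rewrite -/(del c j u) nfin_del // relab_comp; apply: eq_relab => x _ /=.
by rewrite /unbump; lia.
Qed.
Lemma del_ocompr c k j u v : well_labelled u ->
  del c (nfin u + j) (ocomp k u v) = ocomp k u (del c j v).
Proof.
move=> wu; rewrite /ocomp /del raw_graft relab_graft; congr graft.
  rewrite raw_id; last by rewrite wlP //; lia.
  by rewrite relab_id // => x; rewrite wlP // /unbump; lia.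
rewrite raw_relab; last by move=> x _; lia.
rewrite !relab_comp; apply: eq_relab => x _ /=.
by rewrite /unbump; lia.
Qed.

Fact OB_leibniz k m n p i j l (h : composable k m n p i j l)
    (hl : composable k m n p (i + 1) j (l + 1))
    (hr : composable k m n p i (j + 1) (l + 1)) x y :
  OBd (OBcomp h x y) = OBcomp hl (OBd x) y + OBcomp hr x (OBd y) *~ (-1) ^+ absz i.
Proof.
elim/OB_ind: x => [|x x' hx hx'|x hx|u hu].
- by rewrite !(OBcomp0l, OBd0) mul0rz addr0.
- by rewrite !(OBcompDl, OBdD) hx hx' mulrzDl addrACA.
- by rewrite !(OBcompNl, OBdN) hx mulNrz opprD.
elim/OB_ind: y => [|y y' hy hy'|y hy|v hv].
- by rewrite !(OBcomp0r, OBd0) mul0rz addr0.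
- by rewrite !(OBcompDr, OBdD) hy hy' ?OBcompDr mulrzDl addrACA.
- by rewrite !(OBcompNr, OBdN) hy ?OBcompNr mulNrz opprD.
have ku : (k < leaves u)%N by rewrite (leaves_valid hu); case/and3P: h.
rewrite OBcomp_gen // !OBd_gen //; last exact: (valid_ocomp h).
rewrite /odiff OBcomp_suml OBcomp_sumr.
rewrite (_ : nfin (ocomp k u v) = (nfin u + nfin v)%N); last by rewrite nfin_graft ?nfin_relab.
rewrite big_split_ord /=; congr (_ + _).
  apply: eq_bigr => a _; rewrite OBcompSl OBcompDl OBcompNl /collapse /break.
  by rewrite !OBcomp_gen ?del_ocompl ?(wl_valid hu) //; apply: valid_del.
have -> : absz i = nfin u by rewrite (nfin_valid hu); lia.
rewrite (big_morph (fun z => z *~ (-1) ^+ nfin u) (fun a b => mulrzDl _ a b) (mul0rz _ _)).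
apply: eq_bigr => a _; rewrite OBcompSr OBcompDr OBcompNr /collapse /break.
rewrite !OBcomp_gen ?del_ocompr ?(wl_valid hu) //; try apply: valid_del => //.
by rewrite -mulrzA -exprD !sgE; congr (if odd _ then _ else _); lia.
Qed.

Lemma del_del c c' j j' u : (j <= j')%N -> 
  del c' j' (del c j u) = del c j (del c' j'.+1 u).
Proof.
move=> jj; rewrite /del.
have e1 : j' = unbump j j'.+1 by rewrite /unbump; lia.
have e2 : j = unbump j'.+1 j by rewrite /unbump; lia.
rewrite [in LHS]e1 raw_relab -?e1; last first.
  by move=> x; rewrite raw_fin mem_filter => /andP[xj _]; rewrite /unbump; lia.
rewrite [X in _ = relab _ (raw _ X _)]e2 raw_relab; last first.
  by move=> x; rewrite raw_fin mem_filter => /andP[xj _]; rewrite /unbump; lia.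
rewrite raw_comm; last lia.
rewrite !relab_comp; apply: eq_relab => x.
rewrite !raw_fin !mem_filter => /and3P[h1 h2 _] /=.
by rewrite /unbump; lia.
Qed.

Fact OB_dd n i (x : OB n i) : OBd (OBd x) = 0.
Proof.
elim/OB_ind: x => [|x x' hx hx'|x hx|u hu].
- by rewrite !OBd0.
- by rewrite !OBdD hx hx' addr0.
- by rewrite !OBdN hx oppr0.
rewrite OBd_gen // OBd_sum.
have wu := wl_valid hu.
pose F (b : bool * bool) (j j' : nat) : OB n (i + 1 + 1) :=
  ogen n (i + 1 + 1) (del b.2 j' (del b.1 j u)) *~ (-1) ^+ (b.1 + b.2 + j + j').
have E (j : 'I_(nfin u)) :
   OBd ((ogen n (i + 1) (collapse j u) - ogen n (i + 1) (break j u)) *~ (-1) ^+ j.+1)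
   = \sum_(j' < (nfin u).-1) \sum_(b : bool * bool) F b j j'.
  rewrite OBdS OBdD OBdN !OBd_gen; try exact: valid_del.
  rewrite /odiff !nfin_del // -sumrB.
  rewrite (big_morph (fun z => z *~ (-1) ^+ j.+1) (fun a b => mulrzDl _ a b) (mul0rz _ _)).
  apply: eq_bigr => j' _.
  rewrite -(pair_bigA _ (fun b1 b2 => F (b1, b2) j j')) /= !big_bool /=.
  rewrite /F /collapse /break /= !sgE !oddD /=.
  case: (odd j); case: (odd j'); rewrite /= ?opprD ?opprK ?opprB ?addrA;
    rewrite -?addrA; do ?congr (_ + _); rewrite // addrC //.
under eq_bigr => j _ do rewrite E
  (big_ord_widen _ (fun j' => \sum_(b : bool * bool) F b j j') (leq_pred (nfin u))).
rewrite pair_big_dep /= pair_big_dep /=.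
case k: (nfin u) => [|k']; first by rewrite big1 // => -[[[]]].
pose h (x : 'I_k'.+1 * 'I_k'.+1 * (bool * bool)) : 'I_k'.+1 * 'I_k'.+1 * (bool * bool) :=
  let: (j, j', b) := x in (inord j'.+1, inord j, (b.2, b.1)).
pose h' (x : 'I_k'.+1 * 'I_k'.+1 * (bool * bool)) : 'I_k'.+1 * 'I_k'.+1 * (bool * bool) :=
  let: (j, j', b) := x in (inord j', inord j.-1, (b.2, b.1)).
rewrite (bigID (fun x : 'I_k'.+1 * 'I_k'.+1 * (bool * bool) => (x.1.1 <= x.1.2)%N)) /=.
set S1 := (X in X + _ = _); set S2 := (X in _ + X = _).
suff -> : S1 = - S2 by rewrite addNr.
rewrite /S2 -sumrN; apply: (sum_bij (h := h) (h' := h')).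
- move=> [[j j'] [b1 b2]] /= hj; have lj := ltn_ord j; rewrite !inordK; try lia.
  split; first lia.
  by congr (_, _, _); apply: val_inj; rewrite /= !inordK; lia.
- move=> [[j j'] [b1 b2]] /= hj; have lj := ltn_ord j; rewrite !inordK; try lia.
  split; first lia.
  by congr (_, _, _); apply: val_inj; rewrite /= !inordK; lia.
- move=> [[j j'] [b1 b2]] /= hj; have lj := ltn_ord j; rewrite !inordK; try lia.
  rewrite /F /= del_del; last lia.
  rewrite !sgE !oddD /=.
  by case: b1; case: b2; case: (odd j); case: (odd j'); rewrite /= ?opprK.
Qed.

Definition OmegaBAs : dgOperad :=
  @DgOperad OBop OBd OBdD OB_dd OB_leibniz.

(* A stable ribbon tree is a broken one without broken edge; the label true
   marks the edges which are not finite internal edges, hence the outgoing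
   external one. *)
Definition is_srt (n : nat) (t : forest bool) : bool :=
  if t is Node true c Nil then
    [&& stable t, leaves t == n & all negb (labels c)]
  else false.

Definition SRT (n : nat) := {t : forest bool | is_srt n t}.

Fixpoint forests_upto (s : nat) : seq (forest bool) :=
  if s is s'.+1 then
    let fs := forests_upto s' in
    Nil :: [seq Leaf r | r <- fs] ++ [seq Node true c r | c <- fs, r <- fs]
      ++ [seq Node false c r | c <- fs, r <- fs]
  else [:: Nil].

Lemma mem_forests_upto s (f : forest bool) : (fsize f <= s)%N -> f \in forests_upto s.
Proof.
elim: s f => [|s IH] [|r|b c r] //= h.
  by rewrite inE mem_cat map_f ?orbT // IH.
rewrite inE !mem_cat; have hc : c \in forests_upto s by apply: IH; apply: leq_trans (leq_addr _ _) h.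
have hr : r \in forests_upto s by apply: IH; apply: leq_trans (leq_addl _ _) h.
by case: b {h}; rewrite (allpairs_f _ hc hr) ?orbT.
Qed.

Lemma stable_size (L : Type) (f : forest L) : stable f ->
  (fsize f + width f <= 2 * leaves f)%N.
Proof.
rewrite /stable; elim: f => //= [r IH /IH|x c hc r hr /and3P[wc /hc h1 /hr h2]]; lia.
Qed.

Definition SRT_enum n : seq (SRT n) := pmap insub (undup (forests_upto (2 * n))).

Fact SRT_enumP n : Finite.axiom (SRT_enum n).
Proof.
apply: Finite.uniq_enumP; first exact: pmap_sub_uniq (undup_uniq _).
move=> t; rewrite inE mem_pmap_sub mem_undup; apply: mem_forests_upto.
case: t => [[|//|[] c []] //= /and3P[st /eqP <- _]].
have := @stable_size _ _ st; rewrite /=; lia.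
Qed.
HB.instance Definition _ n := Countable.on (SRT n).
HB.instance Definition _ n := isFinite.Build (SRT n) (@SRT_enumP n).

Definition BRT (n : nat) := {t : SRT n | all_vertices (pred1 2%N) (val t)}.

(* The number of internal edges of a stable ribbon tree. *)
Definition nedges (t : forest bool) : nat := count negb (labels t).

Lemma binary_leaves (L : Type) (f : forest L) : all_vertices (pred1 2%N) f ->
  (leaves f = size (labels f) + width f)%N.
Proof.
elim: f => //= [r IH /IH ->|x c hc r hr /and3P[/eqP wc /hc -> /hr ->]].
  by rewrite addnS.
by rewrite size_cat wc; lia.
Qed.

Fact BRT_degree n (t : BRT n) : 2 - n%:Z == - (nedges (val (val t)))%:Z.
Proof.
case: t => [[[|//|[] c []] //= ht] bt]; move: ht bt => /= /and3P[_ /eqP <- al].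
case/and3P=> /eqP wc bc _.
rewrite /nedges /= cats0 !addn0 add0n (binary_leaves bc) wc.
have -> : count negb (labels c) = size (labels c) by apply/eqP; rewrite -all_count.
lia.
Qed.

Definition shape (u : otree) : forest bool := fmap (fun x => x == None) u.
(* An orientation is represented by a sign and an ordering of the internal edges,
   (false, u) and (true, u) standing for the orientation defined by u and for its
   opposite.  Without the sign, a tree with at most one internal edge would only
   have one of its two orientations. *)
Definition ordering (t : forest bool) := {u : otree | (shape u == t) && well_labelled u}.
Definition orientation (t : forest bool) : Type := (bool * ordering t)%type.

(* Every ribbon tree has an ordering: the planar one. *)
Fixpoint planar (k : nat) (t : forest bool) : otree :=
  match t with
  | Nil => Nil
  | Leaf r => Leaf (planar k r)
  | Node true c r => Node None (planar k c) (planar (k + nedges c) r)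
  | Node false c r => Node (Some k) (planar k.+1 c) (planar (k.+1 + nedges c) r)
  end.

Lemma shape_planar k t : shape (planar k t) = t.
Proof.
rewrite /shape.
by elim: t k => //= [r IH k|[] c hc r hr k] /=; rewrite ?IH ?hc ?hr.
Qed.

Lemma fin_planar k t : fin (planar k t) = iota k (nedges t).
Proof.
rewrite /fin /nedges; elim: t k => //= -[] c hc r hr k /=;
  by rewrite pmap_cat hc hr count_cat ?add0n ?add1n iotaD.
Qed.

Fact planar_ordering t :
  (shape (planar 0 t) == t) && well_labelled (planar 0 t).
Proof.
by rewrite shape_planar eqxx /well_labelled /nfin fin_planar size_iota perm_refl.
Qed.

Lemma nedges_shape u : nedges (shape u) = nfin u.
Proof.
rewrite /nedges /shape labels_fmap /nfin /fin count_map.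
by elim: (labels u) => //= -[x|] s /= ->.
Qed.

Fact ordering_valid n i (t : SRT n) (u : ordering (val t)) :
  i == - (nedges (val t))%:Z -> valid n i (val u).
Proof.
case: t u => [t ht] [u /= /andP[/eqP ut wu]] hi; subst t.
rewrite /valid wu -nedges_shape hi /=.
case: u wu ht {hi} => [|//|[x|] c []] //= wu /and3P[].
rewrite /stable /= !andbT addn0 leaves_fmap width_fmap allv_fmap addn0.
by move=> -> ->.
Qed.

Definition m_tree n i (t : SRT n) (o : orientation (val t))
    (hi : i == - (nedges (val t))%:Z) : OmegaBAs n i :=
  pgen (@swapR n i) (Sub (val o.2) (ordering_valid o.2 hi)) *~ (-1) ^+ o.1.

(* Main.v *)
From HB Require Import structures.
From mathcomp Require Import all_boot all_order all_algebra.
From mathcomp Require Import boolp zify.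
Require Import Defs.

Set Implicit Arguments.
Unset Strict Implicit.
Unset Printing Implicit Defensive.

Import GRing.Theory.
Local Open Scope ring_scope.

(** The vertices of a binary tree t with n leaves correspond, in the in-order
traversal, to the n - 1 gaps between consecutive leaves, and each non-root
vertex to the internal edge below it.  Let r be the gap of the root, counted
from 0.  The signs are chosen so that m_n is sent to the sum over t of (-1)^r
times t oriented by the in-order enumeration of its internal edges; that is, the
orientation e_0 ^ ... ^ e_(n-2) in which the outgoing edge e_r is counted too,
contracted by e_r.  In this form the differential is the sum over the edges
e_y other than e_r of (-1)^y times the collapse of e_y minus its breaking.
Rotating an edge whose ends are the gaps y < h exchanges the roles of y and h,
so that the two collapses differ by a cycle of length h - y and cancel.  Breaking
the edge below a subtree whose leaves are preceded by i_1 and followed by i_3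
others moves its edges past i_3 others, which gives the sign (-1)^(i_1 + i_2 i_3)
of A_infinity. *)

(** * Orientations which include the outgoing edge *)

(** [ogen_cyc] and [ogen_blk] concern [ogen] alone; this abstraction makes their signs available for
    [broot], whose arguments carry a label on the outgoing edge. *)
Definition alternating (M : zmodType) (f : otree -> M) :=
  forall u j, well_labelled u -> (j.+1 < nfin u)%N ->
    f (relab (swp j) u) = - f u.

Section Alternating.
Variables (M : zmodType) (f : otree -> M).
Hypothesis falt : alternating f.

Lemma wl_cyc u a q : well_labelled u -> (a + q < nfin u)%N ->
  well_labelled (relab (cyc a q) u).
Proof.
move=> wu h; apply: wl_relab => // [x y _ _|x]; rewrite /cyc; last iflia.
by do ?case: ifP; lia.
Qed.

(** [cyc a q] moves the label [a] up past [q] others, one adjacent exchange at a time. *)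
Lemma alt_cyc u a q : well_labelled u -> (a + q < nfin u)%N ->
  f (relab (cyc a q) u) = f u *~ (-1) ^+ q.
Proof.
move=> wu; elim: q => [|q IH] hq.
  by rewrite relab_id ?expr0 ?mulr1z // => x _; rewrite /cyc; iflia.
have -> : relab (cyc a q.+1) u = relab (swp (a + q)) (relab (cyc a q) u).
  by rewrite relab_comp; apply: eq_relab => x _ /=; rewrite /cyc /swp; iflia.
rewrite falt ?nfin_relab ?wl_cyc ?IH //; try lia.
by rewrite !sgE /=; case: odd; rewrite /= ?opprK.
Qed.

(** The [p] labels of the block move past the [q] others one after the other, the last one first. *)
Lemma alt_blk u a p q : well_labelled u -> (a + p + q <= nfin u)%N ->
  f (relab (blk a p q) u) = f u *~ (-1) ^+ (p * q).
Proof.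
elim: p u => [|p IH] u wu hq.
  by rewrite relab_id ?mul0n ?expr0 ?mulr1z // => x _; rewrite /blk; iflia.
have -> : relab (blk a p.+1 q) u = relab (blk a p q) (relab (cyc (a + p) q) u).
  by rewrite relab_comp; apply: eq_relab => x _ /=; rewrite /cyc /blk; iflia.
rewrite IH ?nfin_relab ?alt_cyc ?wl_cyc //; try lia.
by rewrite -mulrzA -exprD mulSn.
Qed.

End Alternating.

Definition root_label (u : otree) : nat := if u is Node (Some x) _ _ then x else 0.
Definition root_labelled (u : otree) : bool := if u is Node (Some _) _ Nil then true else false.

(* The labels include the outgoing external edge, which [broot] breaks: this is
   the contraction of the orientation by the root. *)
Definition broot n i (u : otree) : OB n i :=
  ogen n i (break (root_label u) u) *~ (-1) ^+ root_label u.

Lemma root_label_fin u : root_labelled u -> root_label u \in fin u.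
Proof. by case: u => //= -[x|//] c [] //= _; rewrite /fin /= mem_head. Qed.

Lemma root_label_relab phi u : root_labelled u ->
  root_label (relab phi u) = phi (root_label u).
Proof. by case: u => //= -[x|//] c []. Qed.

Lemma root_label_del c y u : root_labelled u -> y != root_label u ->
  root_label (del c y u) = unbump y (root_label u).
Proof.
case: u => //= -[x|//] d [] //= _ xy.
by case: c; rewrite /del /= (inj_eq Some_inj) eq_sym (negbTE xy).
Qed.

Lemma root_labelled_del c y u : root_labelled u -> y != root_label u ->
  root_labelled (del c y u).
Proof.
case: u => //= -[x|//] d [] //= _ xy.
by case: c; rewrite /del /= (inj_eq Some_inj) eq_sym (negbTE xy).
Qed.

Lemma root_labelled_relab phi u : root_labelled (relab phi u) = root_labelled u.
Proof. by case: u => //= -[x|//] c []. Qed.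

(** If the exchange avoids the root label, it commutes with the deletion of the root, up to
    renumbering, and [ogen] changes sign. Otherwise the deletion gives the same tree, and the
    exponent in [broot] changes by one. *)
Lemma broot_swp n i u j : root_labelled u -> well_labelled u ->
  (j.+1 < nfin u)%N -> broot n i (relab (swp j) u) = - broot n i u.
Proof.
move=> ru wu ju; have xu : (root_label u < nfin u)%N by rewrite -wlP ?root_label_fin.
rewrite /broot /break root_label_relab //; set x := root_label u in xu *.
have [xj|jx|xj] := ltngtP x j.
- have -> : swp j x = x by rewrite /swp; iflia.
  rewrite del_swp_lt // ogen_swp ?nfin_del //; last lia.
  by rewrite mulNrz.
- have [xS|xS] := eqVneq x j.+1.
    have -> : swp j x = j by rewrite /swp; iflia.
    by rewrite del_swp_eq xS !sgE /=; case: odd; rewrite /= ?opprK.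
  have -> : swp j x = x by rewrite /swp; iflia.
  rewrite del_swp_gt ?ogen_swp ?nfin_del //; try lia.
  by rewrite mulNrz.
- have -> : swp j x = x.+1 by rewrite /swp; iflia.
  by rewrite xj del_swp_eqS !sgE /=; case: odd; rewrite /= ?opprK.
Qed.

(* [broot] is cut off to 0 on the trees without root label to be alternating. *)
Lemma broot_alternating n i :
  alternating (fun u => if root_labelled u then broot n i u else 0).
Proof.
move=> u j wu ju; rewrite root_labelled_relab; case: ifP => ru; last by rewrite oppr0.
exact: broot_swp.
Qed.

Lemma valid_broot n u : root_labelled u -> stable u -> well_labelled u ->
  leaves u = n -> valid n (1 - (nfin u)%:Z) (break (root_label u) u).
Proof.
move=> ru su wu lu; have xu : (root_label u < nfin u)%N by rewrite -wlP ?root_label_fin.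
apply/and5P; split.
- by case: u ru {su wu lu xu} => //= -[x|//] c [] //= _; rewrite eqxx.
- by rewrite stable_relab raw_stable.
- exact: wl_del.
- by rewrite leaves_relab raw_leaves lu.
- by rewrite nfin_del //; apply/eqP; lia.
Qed.

(** The commutation [del_del], freed of the order between the two labels. *)
Lemma del_unbump c x y u : y != x ->
  del c (unbump x y) (del false x u) = del false (unbump y x) (del c y u).
Proof.
move=> xy; have [yx|yx] : (y < x \/ x < y)%N by lia.
  have -> : unbump x y = y by rewrite /unbump; lia.
  have -> : unbump y x = x.-1 by rewrite /unbump; lia.
  by rewrite (@del_del c false y x.-1) ?prednK //; lia.
have -> : unbump x y = y.-1 by rewrite /unbump; lia.
have -> : unbump y x = x by rewrite /unbump; lia.
by rewrite (@del_del false c x y.-1) ?prednK //; lia.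
Qed.

Lemma broot_del n i c y u : root_labelled u -> y != root_label u ->
  broot n i (del c y u) =
    ogen n i (del c (unbump (root_label u) y) (break (root_label u) u))
      *~ (-1) ^+ unbump y (root_label u).
Proof. by move=> ru yx; rewrite /broot root_label_del // /break del_unbump. Qed.

(** A label [y] other than the root label [x] becomes [unbump x y] once the root is deleted, and
    deleting [y] moves the root to [unbump y x]. The two shifts turn the signs (-1)^(j+1) of [odiff]
    into (-1)^y. *)
Lemma OBd_broot n i u : root_labelled u -> stable u -> well_labelled u ->
  leaves u = n -> i = 1 - (nfin u)%:Z ->
  OBd (broot n i u) = \sum_(y < nfin u | y != root_label u :> nat)
    (broot n (i + 1) (collapse y u) - broot n (i + 1) (break y u)) *~ (-1) ^+ y.
Proof.
move=> ru su wu lu ->; have xu : (root_label u < nfin u)%N by rewrite -wlP ?root_label_fin.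
rewrite {1}/broot OBdS OBd_gen; last exact: valid_broot.
rewrite /odiff {2}/break nfin_del // sum_sg.
set x := root_label u in xu *.
(* The labels other than [x] are enumerated as [bump x j]. *)
rewrite [RHS]big_mkcond (bigD1_ord (Ordinal xu)) //= eqxx add0r.
apply: eq_bigr => j _; rewrite eq_sym (neq_bump x j).
have yx : bump x j != x by rewrite eq_sym neq_bump.
rewrite /collapse /break !broot_del // bumpK -mulrzBl -!mulrzA -!exprD !sgE.
by congr (if _ then _ else _); rewrite /bump /unbump; lia.
Qed.

(** * Binary trees labelled in-order *)

Inductive bintree : Type := BLeaf | BNode of bintree & bintree.

Fixpoint bcode t : GenTree.tree unit :=
  if t is BNode l r then GenTree.Node 0 [:: bcode l; bcode r] else GenTree.Leaf tt.
Fixpoint bdecode (c : GenTree.tree unit) : option bintree :=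
  match c with
  | GenTree.Leaf _ => Some BLeaf
  | GenTree.Node _ [:: l; r] =>
      if (bdecode l, bdecode r) is (Some l', Some r') then Some (BNode l' r') else None
  | _ => None
  end.
Lemma bcodeK : pcancel bcode bdecode.
Proof. by elim=> //= l -> r ->. Qed.
HB.instance Definition _ := Countable.copy bintree (pcan_type bcodeK).

Fixpoint gaps t : nat := if t is BNode l r then (gaps l + (gaps r).+1)%N else 0%N.
Definition rootgap t : nat := if t is BNode l _ then gaps l else 0%N.

(** A vertex labels the edge below it by its in-order position, counted from [k]; the outgoing edge
    is thus labelled as well, as [broot] requires. *)
Fixpoint inorder (k : nat) t : otree :=
  if t is BNode l r then
    Node (Some (k + gaps l)%N) (fcat (inorder k l) (inorder (k + gaps l).+1%N r)) Nil
  else Leaf Nil.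

Lemma inorder_node k l r : inorder k (BNode l r) =
  Node (Some (k + gaps l)%N) (fcat (inorder k l) (inorder (k + gaps l).+1 r)) Nil.
Proof. by []. Qed.

Lemma leaves_inorder k t : leaves (inorder k t) = (gaps t).+1.
Proof. by elim: t k => //= l hl r hr k; rewrite leaves_fcat hl hr; lia. Qed.

Lemma width_inorder k t : width (inorder k t) = 1%N.
Proof. by case: t. Qed.

Lemma stable_inorder k t : stable (inorder k t).
Proof.
rewrite /stable; elim: t k => //= l hl r hr k.
by rewrite width_fcat !width_inorder allv_fcat hl hr.
Qed.

Lemma fin_node x c r : fin (Node (Some x) c r) = x :: fin c ++ fin r.
Proof. by rewrite /fin /= pmap_cat. Qed.

Lemma fin_fcat u v : fin (fcat u v) = fin u ++ fin v.
Proof. by rewrite /fin labels_fcat pmap_cat. Qed.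

Lemma fin_inorder k t : perm_eq (fin (inorder k t)) (iota k (gaps t)).
Proof.
elim: t k => //= l hl r hr k; rewrite fin_node fin_fcat cats0 iotaD -cat1s perm_catCA.
by rewrite perm_cat //= perm_cons.
Qed.

Lemma mem_inorder k t x : (x \in fin (inorder k t)) = (k <= x < k + gaps t)%N.
Proof. by rewrite (perm_mem (fin_inorder k t)) mem_iota. Qed.

Lemma nfin_inorder k t : nfin (inorder k t) = gaps t.
Proof. by rewrite /nfin (perm_size (fin_inorder k t)) size_iota. Qed.

Lemma wl_inorder t : well_labelled (inorder 0 t).
Proof. by rewrite /well_labelled nfin_inorder fin_inorder. Qed.

Lemma relab_fcat phi u v : relab phi (fcat u v) = fcat (relab phi u) (relab phi v).
Proof. exact: fmap_fcat. Qed.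

Lemma relab_inorder j k t : relab (addn j) (inorder k t) = inorder (j + k) t.
Proof.
elim: t k => //= l hl r hr k; rewrite /relab /= -!/(relab _ _) relab_fcat hl hr.
by rewrite !addnA !addnS !addnA.
Qed.

(** * Grafting, cutting and rotating binary trees *)

Fixpoint bgraft k t s : bintree :=
  if t is BNode l r then
    if (k <= gaps l)%N then BNode (bgraft k l s) r else BNode l (bgraft (k - (gaps l).+1)%N r s)
  else s.

Lemma gaps_bgraft k t s : gaps (bgraft k t s) = (gaps t + gaps s)%N.
Proof. by elim: t k => //= l hl r hr k; case: ifP => _ /=; rewrite ?hl ?hr; lia. Qed.

(** The leaf [k] stands between the gaps [k - 1] and [k] of [t]: the gaps of [s] are inserted there
    and push the later gaps of [t] by [gaps s]. *)
Lemma inorder_bgraft j k t s : (k <= gaps t)%N ->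
  inorder j (bgraft k t s) =
  graft k (relab (fun x => if (x < j + k)%N then x else (x + gaps s)%N) (inorder j t))
    (inorder (j + k) s).
Proof.
elim: t j k => [|l hl r hr] j k /=.
  by rewrite leqn0 => /eqP ->; rewrite addn0 /= fcat0.
move=> hk; rewrite /relab /= -!/(relab _ _) relab_fcat leaves_fcat !leaves_relab !leaves_inorder.
rewrite [in RHS]ifT; last lia.
rewrite graft_fcat leaves_relab leaves_inorder ltnS.
case: ifP => kl /=.
  rewrite gaps_bgraft ifF; last lia.
  rewrite addnA hl //; congr (Node _ (fcat _ _) _).
  rewrite -[(j + gaps l + gaps s).+1]addSn addnC -relab_inorder; apply: eq_relab => x.
  by rewrite mem_inorder => hx; rewrite ifF; lia.
rewrite ifT; last lia.
congr (Node _ (fcat _ _) _).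
  by rewrite relab_id // => x; rewrite mem_inorder => hx; rewrite ifT //; lia.
rewrite hr; last lia.
by have -> : ((j + gaps l).+1 + (k - (gaps l).+1) = j + k)%N by lia.
Qed.

(** [bsub], [bprune] and [bpos] invert [bgraft]: cutting below the vertex at the gap [y] gives the
    subtree above the cut, the tree that remains, and the leaf of the latter which replaces the
    subtree. *)
Fixpoint bsub t y : bintree :=
  if t is BNode l r then
    if (y < gaps l)%N then bsub l y
    else if y == gaps l then t else bsub r (y - (gaps l).+1)%N
  else BLeaf.
Fixpoint bprune t y : bintree :=
  if t is BNode l r then
    if (y < gaps l)%N then BNode (bprune l y) r
    else if y == gaps l then BLeaf else BNode l (bprune r (y - (gaps l).+1)%N)
  else BLeaf.
Fixpoint bpos t y : nat :=
  if t is BNode l r then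
    if (y < gaps l)%N then bpos l y
    else if y == gaps l then 0%N else ((gaps l).+1 + bpos r (y - (gaps l).+1)%N)%N
  else 0%N.

(** Together with [bgraft_unsplit], this matches the vertices of trees with the ways to write trees
    as grafts of nontrivial subtrees. *)
Lemma bgraft_split t y : (y < gaps t)%N ->
  [/\ bgraft (bpos t y) (bprune t y) (bsub t y) = t,
      (bpos t y + rootgap (bsub t y) = y)%N,
      (bpos t y <= gaps (bprune t y))%N, (0 < gaps (bsub t y))%N &
      (gaps (bprune t y) + gaps (bsub t y) = gaps t)%N].
Proof.
elim: t y => //= l hl r hr y yt.
case: ifP => yl.
  by have [e1 e2 e3 e4 e5] := hl y yl; rewrite /= e3 e1; split => //; lia.
case: eqP => [->|yl'] /=; first by split => //; lia.
have [|e1 e2 e3 e4 e5] := hr (y - (gaps l).+1)%N; first lia.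
rewrite ifF; last lia.
by rewrite addKn e1; split => //; lia.
Qed.

(** Only a cut at the root leaves the trivial tree, so the cuts at the other vertices match
    compositions of operations of arity at least 2. *)
Lemma gaps_bprune_gt0 t y : (y < gaps t)%N -> (0 < gaps (bprune t y))%N = (y != rootgap t).
Proof.
case: t => //= l r yt; case: ifP => yl /=; first by lia.
by case: eqVneq => //= _; lia.
Qed.

Lemma bgraft_unsplit k t s : (k <= gaps t)%N -> (0 < gaps s)%N ->
  let y := (k + rootgap s)%N in
  [/\ bpos (bgraft k t s) y = k, bprune (bgraft k t s) y = t & bsub (bgraft k t s) y = s].
Proof.
move=> + hs /=; elim: t k => [|l hl r hr] k /=.
  rewrite leqn0 => /eqP ->; rewrite add0n.
  by case: s hs => //= a b _; rewrite ltnn eqxx; split.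
have rs : (rootgap s < gaps s)%N by case: s hs {hl hr} => //= a b _; lia.
move=> hk; case: ifP => kl /=.
  rewrite gaps_bgraft !ifT; try lia.
  by have [-> -> ->] := hl k kl.
rewrite !ifF; try lia.
have -> : (k + rootgap s - (gaps l).+1 = (k - (gaps l).+1) + rootgap s)%N by lia.
have [|-> -> ->] := hr (k - (gaps l).+1)%N; first lia.
by split=> //; lia.
Qed.

(* [flip t y] rotates the edge between the vertex at the gap [y] and its parent,
   which is at the gap [parent t y]; both values are junk if [y] is the root gap. *)
Fixpoint flip t y : bintree :=
  if t is BNode l r then
    if (y < gaps l)%N then
      if (y == rootgap l, l) is (true, BNode a b) then BNode a (BNode b r)
      else BNode (flip l y) r
    else if y == gaps l then t
    else let y' := (y - (gaps l).+1)%N in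
      if (y' == rootgap r, r) is (true, BNode b c) then BNode (BNode l b) c
      else BNode l (flip r y')
  else BLeaf.
Fixpoint parent t y : nat :=
  if t is BNode l r then
    if (y < gaps l)%N then if y == rootgap l then gaps l else parent l y
    else let y' := (y - (gaps l).+1)%N in
      if y' == rootgap r then gaps l else ((gaps l).+1 + parent r y')%N
  else 0%N.

Lemma gaps_flip t y : gaps (flip t y) = gaps t.
Proof.
elim: t y => //= l hl r hr y; case: ifP => yl.
  case: eqP => _; last by rewrite /= hl.
  by case: l {hl yl} => [|a b] /=; lia.
case: eqP => // _; case: eqP => _; last by rewrite /= hr.
by case: r {hr} => [|a b] /=; lia.
Qed.

Lemma parent_lt t y : (y < gaps t)%N -> y != rootgap t -> (parent t y < gaps t)%N.
Proof.
elim: t y => //= l hl r hr y yt yl; case: ifP => yl'.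
  by case: eqP => [|/eqP e]; [|have := hl y yl' e]; lia.
by case: eqP => [|/eqP e]; [|have := hr (y - (gaps l).+1)%N _ e]; lia.
Qed.

Lemma parent_neq t y : (y < gaps t)%N -> y != rootgap t -> parent t y != y.
Proof.
elim: t y => //= l hl r hr y yt yl; case: ifP => yl'.
  by case: (y =P rootgap l) => [|/eqP e]; [|have := hl y yl' e]; lia.
by case: (_ =P rootgap r) => [|/eqP e]; [|have := hr (y - (gaps l).+1)%N _ e]; lia.
Qed.

(** Rotation exchanges the two ends of the edge: the former parent becomes the child, and rotating
    the edge below it restores [t]. *)
Lemma flipK t y : (y < gaps t)%N -> y != rootgap t ->
  [/\ parent t y != rootgap (flip t y), parent (flip t y) (parent t y) = y
    & flip (flip t y) (parent t y) = t].
Proof.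
elim: t y => //= l hl r hr y yt yl; case: ifP => yl'.
  case: l hl yt yl yl' => // a b hl yt yl yl'; case: (y =P rootgap (BNode a b)) => [e|/eqP e].
    rewrite /= in e yt yl yl' *; rewrite e.
    have -> : (gaps a + (gaps b).+1 - (gaps a).+1 = gaps b)%N by lia.
    have -> : (gaps a + (gaps b).+1 < gaps a)%N = false by lia.
    have nab : (gaps a + (gaps b).+1 == gaps a)%N = false by lia.
    by rewrite nab eqxx.
  have [h1 h2 h3] := hl y yl' e; have pl := parent_lt yl' e.
  move: h1 h2 h3 pl.
  have := gaps_flip (BNode a b) y; set l' := flip _ y; set h := parent _ y => gl' h1 h2 h3 pl.
  rewrite /= -/l' -/h gl' pl (negbTE h1) h2 h3.
  by split => //; move: pl => /=; lia.
rewrite (negbTE yl); case: r hr yt => [|b c] hr yt; first by move: yt => /=; lia.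
set y' := (y - _)%N; have yt' : (y' < gaps (BNode b c))%N by rewrite /y' /=; move: yt => /=; lia.
case: (y' =P rootgap (BNode b c)) => [e|/eqP e].
  rewrite /= in e yt' *; have gb : (gaps l < gaps l + (gaps b).+1)%N by lia.
  by rewrite !gb eqxx; split=> //; move: e; rewrite /y'; lia.
have [h1 h2 h3] := hr y' yt' e; have pl := parent_lt yt' e.
move: h1 h2 h3 pl.
have := gaps_flip (BNode b c) y'; set l' := flip _ y'; set h := parent _ y' => gl' h1 h2 h3 pl.
rewrite /= -/l' -/h !ifF; try lia.
by rewrite addKn h2 h3; split => //; move: pl; rewrite /y' /=; lia.
Qed.

Lemma coll_inorder_id j k t : ~~ (k <= j < k + gaps t)%N -> coll j (inorder k t) = inorder k t.
Proof. by rewrite -mem_inorder => /(@raw_id true). Qed.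

Lemma coll_node j x c r : coll j (Node (Some x) c r) =
  if x == j then fcat (coll j c) (coll j r) else Node (Some x) (coll j c) (coll j r).
Proof. by []. Qed.

Lemma relab_node phi x c r :
  relab phi (Node (Some x) c r) = Node (Some (phi x)) (relab phi c) (relab phi r).
Proof. by []. Qed.

(** A tree and its rotation have the same collapse, but the merged vertex keeps the label of the
    lower end of the edge, which is [parent t y] in [t] and [y] in [flip t y]; hence the
    relabelling. *)
Lemma coll_flip j t y : (y < gaps t)%N -> y != rootgap t ->
  relab (fun x => if x == (j + y)%N then (j + parent t y)%N else x)
    (coll (j + parent t y) (inorder j (flip t y))) = coll (j + y) (inorder j t).
Proof.
have rid phi k s : (forall x, (k <= x < k + gaps s)%N -> phi x = x) ->
    relab phi (inorder k s) = inorder k s.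
  by move=> h; rewrite relab_id // => x; rewrite mem_inorder => /h.
elim: t j y => // l hl r hr j y yt yl.
rewrite /= in yt yl; rewrite (inorder_node j l r) [flip _ _]/= [parent _ _]/=; case: ifP => yl'.
  case: (y =P rootgap l) => [e|/eqP e].
    (* The edge joins the root to its left child: both collapses are the vertex with the three
       subtrees [a], [b], [r]. *)
    case: l hl yt yl yl' e => // a b hl yt yl yl' e.
    rewrite /= in e yt yl yl' *; rewrite e.
    rewrite !coll_fcat /= !coll_fcat !(inj_eq Some_inj).
    rewrite !coll_inorder_id; try lia.
    have -> : ((j + gaps a).+1 + gaps b = j + (gaps a + (gaps b).+1))%N by lia.
    rewrite !eqxx !ifF; try lia.
    rewrite relab_node !relab_fcat !rid; try (by move=> x hx; rewrite ifF //; lia).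
    by rewrite eqxx /relab /= fcat0 fcatA.
  have pl := parent_lt yl' e; have pn := parent_neq yl' e.
  rewrite (inorder_node j (flip _ _) r) !coll_node !coll_fcat gaps_flip.
  rewrite !ifF; try lia.
  rewrite relab_node relab_fcat hl // (@coll_inorder_id _ _ r); last lia.
  rewrite (@coll_inorder_id _ _ r); last lia.
  by rewrite rid => [|x hx]; rewrite ifF //; lia.
rewrite (negbTE yl); set y' := (y - _)%N; have yt' : (y' < gaps r)%N by rewrite /y'; lia.
have ey : y = ((gaps l).+1 + y')%N by rewrite /y'; lia.
case: (y' =P rootgap r) => [e|/eqP e].
  case: r hr yt e yt' => // b c hr yt e yt'.
  rewrite /= in e yt' *; rewrite ey e !coll_fcat /= !coll_fcat !(inj_eq Some_inj).
  rewrite !coll_inorder_id; try lia.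
  have -> : ((j + gaps l).+1 + gaps b = j + ((gaps l).+1 + gaps b))%N by lia.
  have -> : (j + (gaps l + (gaps b).+1) = j + ((gaps l).+1 + gaps b))%N by lia.
  rewrite !eqxx !ifF; try lia.
  rewrite relab_node !relab_fcat !rid; try (by move=> x hx; rewrite ifF //; lia).
  by rewrite eqxx /relab /= fcat0 fcatA.
have pl := parent_lt yt' e; have pn := parent_neq yt' e.
rewrite (inorder_node j l (flip _ _)) !coll_node !coll_fcat.
rewrite !ifF; try lia.
have ej z : (j + ((gaps l).+1 + z) = (j + gaps l).+1 + z)%N by lia.
rewrite ey !ej relab_node relab_fcat hr // (@coll_inorder_id _ _ l); last lia.
rewrite (@coll_inorder_id _ _ l); last lia.
by rewrite rid => [|x hx]; rewrite ifF //; lia.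
Qed.

(** * The differential of the sum of the binary trees *)

Lemma root_labelled_inorder k t : root_labelled (inorder k t) = (0 < gaps t)%N.
Proof. by case: t => //= l r; lia. Qed.

Lemma root_label_inorder t : root_label (inorder 0 t) = rootgap t.
Proof. by case: t. Qed.

(** The function of [broot_alternating] agrees with [broot] on both trees, so a sign common to all
    alternating functions holds for [broot]. *)
Lemma alt_broot n i phi u e :
  (forall (f : otree -> OB n i), alternating f -> f (relab phi u) = f u *~ (-1) ^+ e) ->
  root_labelled u -> broot n i (relab phi u) = broot n i u *~ (-1) ^+ e.
Proof.
by move=> /(_ _ (@broot_alternating n i)) + ru; rewrite root_labelled_relab ru.
Qed.

(** Let [h] be the parent gap. After renumbering, the relabelling of [coll_flip] is the cycle taking
    [y] to [h - 1], of sign (-1)^(h-1-y); multiplied by (-1)^y it is opposite to (-1)^h. *)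
Lemma broot_collapse_flip n i t y : (y < gaps t)%N -> y != rootgap t ->
  (y < parent t y)%N ->
  broot n i (collapse y (inorder 0 t)) *~ (-1) ^+ y =
  - (broot n i (collapse (parent t y) (inorder 0 (flip t y))) *~ (-1) ^+ parent t y).
Proof.
move=> yt yr yh; have [pr _ _] := flipK yt yr; have ht := parent_lt yt yr.
have ce := coll_flip 0 yt yr.
set h := parent t y in pr ht yh ce *; set t' := flip t y in pr ce *.
have -> : collapse y (inorder 0 t) =
    relab (cyc y (h.-1 - y)) (collapse h (inorder 0 t')).
  rewrite /collapse /del /raw -[y in coll y]add0n -ce !relab_comp; apply: eq_relab => x.
  rewrite !add0n (raw_fin true) mem_filter mem_inorder gaps_flip /cyc /unbump => /andP[xh xt] /=.
  by iflia.
have ht' : (h < nfin (inorder 0 t'))%N by rewrite nfin_inorder gaps_flip.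
rewrite (alt_broot (e := h.-1 - y)).
- rewrite -mulrzA -exprD !sgE.
  have -> : odd (h.-1 - y + y) = ~~ odd h by lia.
  by case: odd; rewrite ?opprK.
- move=> f fa; apply: alt_cyc => //; first exact: wl_del (wl_inorder _) ht'.
  by rewrite nfin_del ?wl_inorder // nfin_inorder gaps_flip; lia.
- apply: root_labelled_del; last by rewrite root_label_inorder.
  by rewrite root_labelled_inorder gaps_flip; lia.
Qed.

Lemma wl_ocomp k u v : (k < leaves u)%N -> well_labelled u -> well_labelled v ->
  well_labelled (ocomp k u v).
Proof.
move=> ku wu wv; rewrite /well_labelled nfin_graft // nfin_relab iotaD.
rewrite (perm_trans (fin_graft _ ku)) // perm_cat // fin_relab.
by rewrite add0n -[X in iota X]addn0 iotaDl perm_map.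
Qed.

Lemma root_labelled_ocomp k u v : (k < leaves u)%N -> root_labelled u ->
  root_labelled (ocomp k u v).
Proof. by case: u => //= -[x|//] c [] //=; rewrite addn0 /ocomp /= => ->. Qed.

Lemma root_label_ocomp k u v : root_labelled u -> root_label (ocomp k u v) = root_label u.
Proof. by case: u => //= -[x|//] c [] //= _; rewrite /ocomp /=; case: ifP. Qed.

(** With [k] = i_1, [n] = i_2 and [gaps t - k] = i_3, this is the sign of A_infinity. *)
Lemma broot_break_bgraft k m n p i j l (h : composable k m n p i j l) t s :
  (0 < gaps t)%N -> (0 < gaps s)%N -> m = (gaps t).+1 -> n = (gaps s).+1 ->
  i = 1 - (gaps t)%:Z -> j = 1 - (gaps s)%:Z ->
  broot p l (break (k + rootgap s) (inorder 0 (bgraft k t s))) *~ (-1) ^+ (k + rootgap s) =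
  OBcomp h (broot m i (inorder 0 t)) (broot n j (inorder 0 s))
    *~ (-1) ^+ (k + n * (gaps t - k)).
Proof.
move=> t0 s0 em en ei ej; have kt : (k < (gaps t).+1)%N by case/and3P: h; rewrite em.
set X := inorder 0 t; set Y := inorder 0 s; set r := rootgap s.
have nX : nfin X = gaps t by rewrite nfin_inorder.
have nY : nfin Y = gaps s by rewrite nfin_inorder.
have wX : well_labelled X by exact: wl_inorder.
have wY : well_labelled Y by exact: wl_inorder.
have rs : (r < gaps s)%N by rewrite /r; case: (s) s0 => //= a b _; lia.
have rX : root_labelled X by rewrite root_labelled_inorder.
have xt : (rootgap t < nfin X)%N by rewrite nX; case: (t) t0 => //= a b _; lia.
have kX : (k < leaves X)%N by rewrite leaves_inorder.
have nbY : nfin (break r Y) = (gaps s).-1 by rewrite nfin_del ?nY.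
(* In the composite all labels of [t] precede those of [s]; in-order, the last [gaps t - k] of them
   come after the [(gaps s).-1] remaining labels of [s]. *)
have -> : break (k + r) (inorder 0 (bgraft k t s)) =
    relab (blk k (gaps t - k) (gaps s).-1) (ocomp k X (break r Y)).
  rewrite inorder_bgraft // /break /del raw_graft.
  rewrite /ocomp !relab_graft !relab_comp; congr graft.
    rewrite raw_id; last first.
      rewrite fin_relab; apply/mapP => -[x]; rewrite mem_inorder => hx; case: ifP; lia.
    rewrite relab_comp; apply: eq_relab => x; rewrite mem_inorder /blk /unbump => hx /=.
    by iflia.
  rewrite !add0n -[in inorder k s](addn0 k) -relab_inorder raw_relab => [|x _]; last lia.
  rewrite !relab_comp nX; apply: eq_relab => x.
  by rewrite (raw_fin false) mem_filter mem_inorder /blk /unbump /= => hx; iflia.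
rewrite (alt_broot (e := (gaps t - k) * (gaps s).-1)); first last.
- exact: root_labelled_ocomp.
- move=> f fa; apply: alt_blk => //.
    by apply: wl_ocomp => //; apply: wl_del => //; rewrite nY.
  by rewrite nfin_graft // nfin_relab nX nbY; lia.
rewrite [X in X *~ _ *~ _]/broot root_label_ocomp // {1}/break.
rewrite del_ocompl ?root_label_inorder //.
rewrite /broot !root_label_inorder OBcompSl OBcompSr OBcomp_gen -?mulrzA -?exprD.
- rewrite !sgE; congr (if _ then _ else _).
  (* [n] has the parity of [(gaps s).-1], and (-1)^r cancels against the sign in the [broot] of
     [s]. *)
  have -> : n = (gaps s).-1.+2 by lia.
  rewrite -/r !(oddD, oddM) /= !negbK.
  by case: (odd r); case: (odd (rootgap t)); case: (odd k); case: (odd _); case: (odd _).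
- by rewrite ei -nX -root_label_inorder valid_broot ?stable_inorder ?leaves_inorder.
- rewrite ej -nY -root_label_inorder valid_broot ?stable_inorder ?leaves_inorder //.
  by rewrite root_labelled_inorder.
Qed.


Lemma OBd_broot_inorder n i t : (0 < gaps t)%N -> n = (gaps t).+1 -> i = 1 - (gaps t)%:Z ->
  OBd (broot n i (inorder 0 t)) = \sum_(y < gaps t | y != rootgap t :> nat)
    (broot n (i + 1) (collapse y (inorder 0 t)) - broot n (i + 1) (break y (inorder 0 t)))
      *~ (-1) ^+ y.
Proof.
move=> t0 -> ->; rewrite OBd_broot ?root_labelled_inorder ?stable_inorder ?wl_inorder //
  ?leaves_inorder ?nfin_inorder ?root_label_inorder //.
Qed.

(** * Sums over all binary trees *)

Fixpoint bintrees_upto (s : nat) : seq bintree :=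
  if s is s'.+1 then
    BLeaf :: [seq BNode l r | l <- bintrees_upto s', r <- bintrees_upto s']
  else [:: BLeaf].

Lemma mem_bintrees_upto s t : (gaps t <= s)%N -> t \in bintrees_upto s.
Proof.
elim: s t => [|s IH] [|l r] //= h; first by lia.
by rewrite inE allpairs_f ?orbT // IH //; lia.
Qed.

(** One bound for all arities lets a tree and the two trees obtained by cutting it be indexed by the
    same finite type. *)
Definition small_tree n := {t : bintree | (gaps t <= n)%N}.
Definition small_tree_enum n : seq (small_tree n) := pmap insub (undup (bintrees_upto n)).
Fact small_tree_enumP n : Finite.axiom (small_tree_enum n).
Proof.
apply: Finite.uniq_enumP; first exact: pmap_sub_uniq (undup_uniq _).
by move=> t; rewrite inE mem_pmap_sub mem_undup mem_bintrees_upto ?(valP t).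
Qed.
HB.instance Definition _ n := Countable.on (small_tree n).
HB.instance Definition _ n := isFinite.Build (small_tree n) (@small_tree_enumP n).

Definition small n t : small_tree n := insubd (Sub BLeaf isT : small_tree n) t.
Lemma val_small n t : (gaps t <= n)%N -> val (small n t) = t.
Proof. by move=> h; rewrite val_insubd h. Qed.

(** For [2 <= n] and [n.-1 <= K] this is the image of [m_n], see [m_BRT_bin]. *)
Definition m_bin K n : OmegaBAs n (2 - n%:Z) :=
  \sum_(t : small_tree K | gaps (val t) == n.-1)
    (broot n (2 - n%:Z) (inorder 0 (val t)) : OmegaBAs n _).

(** Rotation is an involution on pairs of a tree and a non-root vertex; it exchanges the cases
    [y < parent t y] and [parent t y < y], whose terms cancel by [broot_collapse_flip]. *)
Lemma collapse_sum0 n i g :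
  \sum_(x : small_tree g * 'I_g | (gaps (val x.1) == g) && (x.2 != rootgap (val x.1) :> nat))
    broot n i (collapse x.2 (inorder 0 (val x.1))) *~ (-1) ^+ x.2 = 0 :> OB n i.
Proof.
case: g => [|g]; first by rewrite big1 // => -[t []].
rewrite (bigID (fun x : small_tree g.+1 * 'I_g.+1 => x.2 < parent (val x.1) x.2)%N) /=.
set S1 := (X in X + _); set S2 := (X in _ + X); suff -> : S1 = - S2 by rewrite addNr.
rewrite {}/S1 {}/S2 -sumrN.
pose h (x : small_tree g.+1 * 'I_g.+1) : small_tree g.+1 * 'I_g.+1 :=
  (small g.+1 (flip (val x.1) x.2), inord (parent (val x.1) x.2)).
have hP (x : small_tree g.+1 * 'I_g.+1) :
    (gaps (val x.1) == g.+1) && (x.2 != rootgap (val x.1) :> nat) ->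
    [/\ val (h x).1 = flip (val x.1) x.2, (h x).2 = parent (val x.1) x.2 :> nat,
      (gaps (val (h x).1) == g.+1) && ((h x).2 != rootgap (val (h x).1) :> nat),
      h (h x) = x & parent (val (h x).1) (h x).2 = x.2].
  case: x => t y /= /andP[/eqP gt yr]; have yt : (y < gaps (val t))%N by rewrite gt.
  have [r1 p1 f1] := flipK yt yr; have pt := parent_lt yt yr.
  have gf := gaps_flip (val t) y.
  have e1 : val (small g.+1 (flip (val t) y)) = flip (val t) y by rewrite val_small ?gf ?gt.
  have e2 : (inord (parent (val t) y) : 'I_g.+1) = parent (val t) y :> nat.
    by rewrite inordK //; move: pt; rewrite gt.
  rewrite e1 e2 gf gt eqxx r1 p1; split=> //.
  rewrite /h /= e1 e2 p1 f1; congr (_, _); apply: val_inj; rewrite /= ?inordK //.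
  by rewrite val_small // gt.
apply: (sum_bij (h := h) (h' := h)) => x /andP[px lx].
- by have [e1 e2 hx hhx e3] := hP x px; rewrite hx hhx e3 e2 -leqNgt ltnW.
- have [e1 e2 hx hhx e3] := hP x px; rewrite hx hhx e3 e2; split=> //=.
  by case/andP: px => /eqP gt yr; rewrite ltn_neqAle parent_neq ?gt // leqNgt lx.
have [e1 e2 hx hhx e3] := hP x px; case/andP: px => /eqP gt yr.
by rewrite e1 e2 broot_collapse_flip // gt.
Qed.

(** By bilinearity and [broot_break_bgraft], each pair of trees contributes the breaking, in their
    graft, of the edge which joins them. *)
Lemma cmp_m_bin M K n (x : 'I_M * 'I_M * 'I_M) : P3 n x ->
  cmp x.1.1 n (2 - n%:Z + 1) (m_bin K (x.1.1 + 1 + x.2)) (m_bin K x.1.2)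
    *~ (-1) ^+ (x.1.1 + x.1.2 * x.2) =
  \sum_(t : small_tree K * small_tree K |
      (gaps (val t.1) == x.1.1 + x.2)%N && (gaps (val t.2) == x.1.2.-1))
    broot n (2 - n%:Z + 1) (break (x.1.1 + rootgap (val t.2))
        (inorder 0 (bgraft x.1.1 (val t.1) (val t.2))))
      *~ (-1) ^+ (x.1.1 + rootgap (val t.2)) :> OmegaBAs _ _.
Proof.
move=> hx; rewrite /m_bin cmp_suml sum_sg.
under eq_bigr => t _ do rewrite cmp_sumr sum_sg.
rewrite pair_big_dep; case: x hx => [[i1 i2] i3]; rewrite /P3 /= => hx.
apply: eq_big => [t|[t s] /= /andP[/eqP gt /eqP gs]].
  by congr (_ && _); congr (_ == _); lia.
have hc : composable i1 (i1 + 1 + i3) i2 n (2 - (i1 + 1 + i3)%N%:Z) (2 - i2%:Z) (2 - n%:Z + 1).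
  by comp_lia.
rewrite (cmpE hc) (broot_break_bgraft hc); try lia.
by congr (_ *~ (-1) ^+ _); rewrite gt; lia.
Qed.

Lemma OBd_m_bin_break g : (0 < g)%N -> let n := g.+1 in
  OBd (m_bin g n) = - \sum_(x : small_tree g * 'I_g |
      (gaps (val x.1) == g) && (x.2 != rootgap (val x.1) :> nat))
    broot n (2 - n%:Z + 1) (break x.2 (inorder 0 (val x.1))) *~ (-1) ^+ x.2.
Proof.
move=> g0 n; rewrite -[RHS]add0r.
(* The vanishing sum of the collapses is added, so that the two sides can be compared tree by
   tree. *)
rewrite -[X in _ = X + _](@collapse_sum0 n (2 - n%:Z + 1) g) -sumrB /m_bin OBd_sum.
pose F t y := (broot n (2 - n%:Z + 1) (collapse y (inorder 0 t)) -
  broot n (2 - n%:Z + 1) (break y (inorder 0 t))) *~ (-1) ^+ y.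
rewrite [RHS](eq_bigr (fun x : small_tree g * 'I_g => F (val x.1) x.2)) => [|x _]; last first.
  by rewrite /F mulrzBl.
rewrite -(pair_big_dep (fun t : small_tree g => gaps (val t) == g)
    (fun t (y : 'I_g) => y != rootgap (val t) :> nat) (fun t y => F (val t) y)) /=.
apply: eq_bigr => t /eqP gt; rewrite OBd_broot_inorder; try by rewrite gt /n; lia.
by rewrite gt; apply: eq_bigr => y _.
Qed.

Lemma OBd_m_bin g : (0 < g)%N -> let n := g.+1 in
  OBd (m_bin g n) = - \sum_(i1 < n) \sum_(i2 < n | (2 <= i2)%N)
    \sum_(i3 < n | (i1 + i2 + i3 == n)%N)
      (cmp i1 n (2 - n%:Z + 1) (m_bin g (i1 + 1 + i3)) (m_bin g i2)
        *~ (-1) ^+ (i1 + i2 * i3) : OmegaBAs _ _).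
Proof.
move=> g0 n.
rewrite (@sum3_widen _ n n (fun i1 i2 i3 =>
  cmp i1 n (2 - n%:Z + 1) (m_bin g (i1 + 1 + i3)) (m_bin g i2)
        *~ (-1) ^+ (i1 + i2 * i3))) //.
under [in RHS]eq_bigr => x px do rewrite cmp_m_bin //.
pose B t y := broot n (2 - n%:Z + 1) (break y (inorder 0 t)) *~ (-1) ^+ y.
pose P (x : small_tree g * 'I_g) := (gaps (val x.1) == g) && (x.2 != rootgap (val x.1) :> nat).
transitivity (- \sum_(x | P x) B (val x.1) x.2 : OB n (2 - n%:Z + 1)).
  exact: OBd_m_bin_break.
congr (- _).
pose Q (z : 'I_n * 'I_n * 'I_n * (small_tree g * small_tree g)) := P3 n z.1 &&
  ((gaps (val z.2.1) == z.1.1.1 + z.1.2)%N && (gaps (val z.2.2) == z.1.1.2.-1)).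
rewrite pair_big_dep.
(* Cutting below [y] gives the indices: i_2 counts the leaves of the subtree, i_1 and i_3 the other
   leaves to its left and right. *)
pose h (x : small_tree g * 'I_g) : 'I_n * 'I_n * 'I_n * (small_tree g * small_tree g) :=
  let: (t, y) := x in let k := bpos (val t) y in
  let p := bprune (val t) y in let s := bsub (val t) y in
  (inord k, inord (gaps s).+1, inord (gaps p - k), (small g p, small g s)).
pose h' (z : 'I_n * 'I_n * 'I_n * (small_tree g * small_tree g)) : small_tree g * 'I_g :=
  (small g (bgraft z.1.1.1 (val z.2.1) (val z.2.2)),
   insubd (Ordinal g0) (z.1.1.1 + rootgap (val z.2.2))%N).
apply: (sum_bij (h := h) (h' := h')).
- move=> [[t ht] y]; rewrite /P /= => /andP[/eqP gt yr].
  have yt : (y < gaps t)%N by rewrite gt.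
  (* Since [y] is not the root, the pruned tree is nontrivial; this gives i_2 < n. *)
  have [e1 e2 e3 e4 e5] := bgraft_split yt; have := gaps_bprune_gt0 yt.
  rewrite yr gt in e5 * => e6.
  rewrite /h /h' /Q /P3 /= !inordK; try by rewrite /n; lia.
  rewrite !val_small; try lia.
  split; first by rewrite /n; lia.
  rewrite e1 e2; congr (_, _); apply: val_inj; rewrite /= ?val_small ?gt //.
  by rewrite val_insubd ltn_ord.
- move=> [[[i1 i2] i3] [[t ht] [s hs]]]; rewrite /Q /P3 /h' /P /= => hz.
  have s0 : (0 < gaps s)%N by lia.
  have kt : (i1 <= gaps t)%N by lia.
  have [e1 e2 e3] := bgraft_unsplit kt s0.
  have rs : (rootgap s < gaps s)%N by case: (s) s0 => //= a b _; lia.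
  have gz : gaps (bgraft i1 t s) = g by rewrite gaps_bgraft; move: hz; rewrite /n; lia.
  have yg : (i1 + rootgap s < g)%N by move: hz; rewrite /n; lia.
  have yz : (i1 + rootgap s < gaps (bgraft i1 t s))%N by rewrite gz.
  have := gaps_bprune_gt0 yz.
  rewrite val_small ?gz // val_insubd yg e1 e2 e3 eqxx => <-.
  split; first by move: hz; rewrite /n; lia.
  by congr (_, _, _, (_, _)); apply: val_inj; rewrite /= ?inordK ?val_small //;
    move: hz; rewrite /n; lia.
- move=> [[t ht] y]; rewrite /P /= => /andP[/eqP gt yr].
  have yt : (y < gaps t)%N by rewrite gt.
  have [e1 e2 e3 e4 e5] := bgraft_split yt; have := gaps_bprune_gt0 yt.
  rewrite yr gt in e5 * => e6.
  rewrite !inordK; try by rewrite /n; lia.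
  by rewrite !val_small ?e1 ?e2 //; lia.
Qed.

(** * Comparison with the binary ribbon trees *)

Lemma planar_shape k u : fin u = iota k (nfin u) -> planar k (shape u) = u.
Proof.
rewrite /shape; elim: u k => [k|r IH k|[x|] c hc r hr k] //.
- by move=> /IH /= ->.
- have -> : nfin (Node (Some x) c r) = (nfin c + nfin r).+1.
    by rewrite /nfin fin_node /= size_cat.
  rewrite fin_node [iota _ _]/= iotaD => -[-> /eqP].
  rewrite eqseq_cat ?size_iota // => /andP[/eqP ec /eqP er].
  by rewrite /= hc // nedges_shape hr.
- have -> : nfin (Node None c r) = (nfin c + nfin r)%N.
    by rewrite /nfin {1}/fin /= pmap_cat size_cat.
  rewrite {1}/fin /= pmap_cat iotaD => /eqP.
  rewrite eqseq_cat ?size_iota // => /andP[/eqP ec /eqP er].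
  by rewrite /= hc // nedges_shape hr.
Qed.

Lemma shape_relab phi u : shape (relab phi u) = shape u.
Proof. by rewrite /shape /relab fmap_comp; apply: eq_fmap => -[]. Qed.

(** The inverse of [cyc a q]. *)
Definition uncyc a q x :=
  if x == (a + q)%N then a else if (a <= x < a + q)%N then x.+1 else x.

(* Bubble sort: the labels met first in the planar order are put in place one after the other. *)
Lemma ogen_planar n i u : well_labelled u ->
  exists e : bool, ogen n i u = ogen n i (planar 0 (shape u)) *~ (-1) ^+ e.
Proof.
suff H k v : well_labelled v -> (k <= nfin v)%N -> take k (fin v) = iota 0 k ->
    exists e : bool, ogen n i v = ogen n i (planar 0 (shape v)) *~ (-1) ^+ e.
  by move=> wu; apply: (H 0%N) => //; rewrite take0.
have [m hm] : exists m, (nfin v - k <= m)%N by exists (nfin v); lia.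
elim: m k v hm => [|m IH] k v hm wv kv tk.
  exists false; rewrite expr0 mulr1z planar_shape //.
  have ek : k = nfin v by lia.
  by rewrite ek take_size in tk.
have [ek|kn] := eqVneq k (nfin v); first by apply: (IH k) => //; lia.
have {kn}kv : (k < nfin v)%N by lia.
set w := nth 0%N (fin v) k.
have wn : (w < nfin v)%N by rewrite -wlP //; apply: mem_nth.
(* The labels below [k] already occupy the first [k] places, and labels are distinct. *)
have kw : (k <= w)%N.
  rewrite leqNgt; apply/negP => wk.
  have : w \in take k (fin v) by rewrite tk mem_iota.
  have := wl_uniq wv; rewrite -{1}(cat_take_drop k (fin v)) cat_uniq => /and3P[_ /hasPn h _].
  apply/negP; apply: h; rewrite /w -[k in nth _ _ k]addn0 -nth_drop.
  by rewrite mem_nth // size_drop subn_gt0.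
set v' := relab (uncyc k (w - k)) v.
have ev : v = relab (cyc k (w - k)) v'.
  by rewrite /v' relab_comp relab_id // => x _ /=; rewrite /cyc /uncyc; iflia.
have wv' : well_labelled v'.
  apply: wl_relab => // [x y _ _|x]; rewrite /uncyc; last iflia.
  by do ?case: ifP; lia.
have sv' : shape v' = shape v by rewrite shape_relab.
have nv' : nfin v' = nfin v by rewrite nfin_relab.
have [||//||e he] := IH k.+1 v'; rewrite ?nv' //; first lia.
  rewrite fin_relab -map_take (take_nth 0%N) // tk map_rcons -/w -addn1 iotaD cats1.
  congr rcons; last by rewrite /uncyc; iflia.
  by rewrite -[RHS]map_id; apply/eq_in_map => x; rewrite mem_iota /uncyc => hx; iflia.
exists (odd (w - k) (+) e); rewrite {1}ev ogen_cyc ?nv' ?he ?sv'; last lia.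
rewrite -mulrzA -exprD !sgE; congr (if _ then _ else _).
by rewrite oddD oddb addbC; case: (_ (+) _).
Qed.

(** [b] is [true] if the edge below the root is the outgoing external edge, and [false] if it is
    internal. *)
Fixpoint tree_shape (b : bool) t : forest bool :=
  if t is BNode l r then Node b (fcat (tree_shape false l) (tree_shape false r)) Nil
  else Leaf Nil.

Lemma leaves_tree_shape b t : leaves (tree_shape b t) = (gaps t).+1.
Proof. by elim: t b => //= l hl r hr b; rewrite leaves_fcat hl hr; lia. Qed.

Lemma width_tree_shape b t : width (tree_shape b t) = 1%N.
Proof. by case: t. Qed.

Lemma binary_tree_shape b t : all_vertices (pred1 2%N) (tree_shape b t).
Proof.
by elim: t b => //= l hl r hr b; rewrite width_fcat !width_tree_shape allv_fcat hl hr.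
Qed.

Lemma labels_tree_shape t : all negb (labels (tree_shape false t)).
Proof. by elim: t => //= l hl r hr; rewrite labels_fcat !all_cat hl hr. Qed.

Lemma stable_binary (f : forest bool) : all_vertices (pred1 2%N) f -> stable f.
Proof.
rewrite /stable; elim: f => //= x c hc r hr /and3P[/eqP -> bc br].
by rewrite hc ?hr.
Qed.

Lemma shape_inorder k t : shape (inorder k t) = tree_shape false t.
Proof.
rewrite /shape; elim: t k => //= l hl r hr k.
by rewrite fmap_fcat hl hr.
Qed.

Lemma shape_break_root t : (0 < gaps t)%N ->
  shape (break (rootgap t) (inorder 0 t)) = tree_shape true t.
Proof.
case: t => // l r _; rewrite /break /del shape_relab inorder_node add0n.
rewrite [RHS]/= -(shape_inorder 0 l) -(shape_inorder (gaps l).+1 r) /=.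
have -> c : shape (brk (gaps l) (Node (Some (gaps l)) c Nil)) =
    Node true (shape (brk (gaps l) c)) Nil.
  by rewrite /shape /= eqxx.
have bid k t : ~~ (k <= gaps l < k + gaps t)%N -> brk (gaps l) (inorder k t) = inorder k t.
  by move=> h; rewrite [LHS](@raw_id false) // mem_inorder.
by rewrite /brk fmap_fcat -!/(brk _ _) !bid ?/shape ?fmap_fcat //; lia.
Qed.

(** Left inverse to [tree_shape], with junk value [BLeaf] at vertices which are not binary. *)
Fixpoint decode (f : forest bool) : seq bintree :=
  match f with
  | Nil => [::]
  | Leaf r => BLeaf :: decode r
  | Node _ c r => (if decode c is [:: a; b] then BNode a b else BLeaf) :: decode r
  end.
Definition tree_of (f : forest bool) : bintree := head BLeaf (decode f).

Lemma decode_fcat f g : decode (fcat f g) = decode f ++ decode g.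
Proof. by elim: f => //= [r ->|x c _ r ->]. Qed.

Lemma tree_shapeK b : cancel (tree_shape b) tree_of.
Proof.
have dec c t : decode (tree_shape c t) = [:: t].
  by elim: t c => //= l hl r hr c; rewrite decode_fcat hl hr.
by move=> t; rewrite /tree_of dec.
Qed.

Lemma decodeK (f : forest bool) : all_vertices (pred1 2%N) f -> all negb (labels f) ->
  foldr (fun t => fcat (tree_shape false t)) Nil (decode f) = f /\ size (decode f) = width f.
Proof.
elim: f => //= [r IH br /(IH br)[-> ->] //|x c hc r hr /and3P[/eqP wc bc br]].
rewrite all_cat => /and3P[/negbTE -> nc nr].
have [e1 e2] := hc bc nc; have [e3 e4] := hr br nr.
rewrite e4; split=> //; move: e1; rewrite wc in e2.
case: (decode c) e2 => [|a [|b []]] //= _ e1.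
by rewrite e3 -e1 fcat0.
Qed.

Lemma tree_ofK n (t : SRT n) : all_vertices (pred1 2%N) (val t) ->
  tree_shape true (tree_of (val t)) = val t.
Proof.
case: t => [[|//|[] c []] //= ht] /and3P[/eqP wc bc _].
have /and3P[_ _ nc] := ht; have [e1 e2] := decodeK bc nc.
rewrite /tree_of /=; move: e1; rewrite wc in e2.
by case: (decode c) e2 => [|a [|b []]] //= _ <-; rewrite fcat0.
Qed.

Lemma gaps_tree_of n (t : BRT n) : (gaps (tree_of (val (val t)))).+1 = n.
Proof.
rewrite -(leaves_tree_shape true) tree_ofK; last exact: valP t.
by case: t => [[[|//|[] c []] //= ht] _]; case/and3P: ht => _ /eqP.
Qed.

Definition m_BRT n i : OmegaBAs n i :=
  \sum_(t : BRT n) broot n i (inorder 0 (tree_of (val (val t)))).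

Lemma is_srt_tree_shape t : (0 < gaps t)%N -> is_srt (gaps t).+1 (tree_shape true t).
Proof.
case: t => // l r _; have := stable_binary (binary_tree_shape true (BNode l r)).
have := leaves_tree_shape true (BNode l r) => /= -> ->.
by rewrite eqxx labels_fcat all_cat !labels_tree_shape.
Qed.

Lemma m_BRT_bin K n : (2 <= n)%N -> (n.-1 <= K)%N -> m_BRT n (2 - n%:Z) = m_bin K n.
Proof.
move=> n2 nN; rewrite /m_bin.
pose h (t : BRT n) := small K (tree_of (val (val t))).
have hE t : val (h t) = tree_of (val (val t)).
  by rewrite val_small //; have := gaps_tree_of t; lia.
(* The inverse is partial: trees whose number of gaps is not [n.-1] give no element of [BRT n]. *)
pose h' (t : small_tree K) : option (BRT n) :=
  obind (fun s : SRT n => insub s) (insub (tree_shape true (val t)) : option (SRT n)).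
have h'K t : h' (h t) = Some t.
  by rewrite /h' hE tree_ofK ?(valP t) // valK /= valK.
rewrite [RHS](reindex_omap h h') => [|t /eqP gt].
  apply: eq_big => t; rewrite hE // h'K eqxx andbT.
  by apply/esym/eqP; have := gaps_tree_of t; lia.
have : is_srt n (tree_shape true (val t)).
  by have := @is_srt_tree_shape (val t); rewrite gt prednK; [apply|]; lia.
rewrite /h' => st; rewrite insubT /= insubT /=; first exact: binary_tree_shape.
move=> bt; congr Some; apply: val_inj; rewrite hE /=.
exact: tree_shapeK.
Qed.

(** * The morphism out of the quasi-free operad *)

Definition m_gen n i (e : Ainf_gen n i) : OmegaBAs n i := m_BRT n i.

(** The Leibniz rule applied to the composite of the unit with itself reads d(id) = d(id) +
    d(id). *)
Lemma dg_d_id (P : dgOperad) : dg_d (op_id P) = 0.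
Proof.
have h : composable 0 1 1 1 0 0 0 by [].
have h' : composable 0 1 1 1 (0 + 1) 0 (0 + 1) by [].
have h'' : composable 0 1 1 1 0 (0 + 1) (0 + 1) by [].
have := dg_leibniz h h' h'' (op_id P) (op_id P).
rewrite op_id_l op_id_r op_id_l mulr1z => /eqP.
by rewrite -subr_eq subrr eq_sym => /eqP.
Qed.

Lemma gmN P Q (f : gradedMorphism P Q) n i x : f n i (- x) = - f n i x.
Proof. by apply: (@addrI _ (f n i x)); rewrite -gm_add !subrr gm0. Qed.

Lemma gm_sg P Q (f : gradedMorphism P Q) n i x e :
  f n i (x *~ (-1) ^+ e) = f n i x *~ (-1) ^+ e.
Proof. by rewrite !sgE; case: odd; rewrite ?gmN. Qed.

Lemma gm_sum P Q (f : gradedMorphism P Q) (I : Type) (s : seq I) (A : pred I) n i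
    (F : I -> P n i) :
  f n i (\sum_(t <- s | A t) F t) = \sum_(t <- s | A t) f n i (F t).
Proof. by elim/big_rec2: _ => [|t x y _ <-]; rewrite ?gm0 ?gm_add. Qed.

Section QuasiFree.
Variables (E : nat -> int -> Type) (delta : forall n i, E n i -> free_operad E n (i + 1)).
Hypothesis dd : forall n i (e : E n i), free_d delta (delta e) = 0.
Variables (Q : dgOperad) (q : forall n i, E n i -> Q n i).
Hypothesis dq : forall n i (e : E n i), free_lift q n (i + 1) (delta e) = dg_d (q e).

(** Both sides are derivations along the lift, so it suffices that they agree on the generators,
    which is [dq]. *)
Lemma free_lift_d n i (x : quasi_free dd n i) :
  free_lift q n (i + 1) (dg_d x) = dg_d (free_lift q n i x).
Proof.
have d0 m j : dg_d (0 : Q m j) = 0.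
  by apply: (@addrI _ (dg_d (0 : Q m j))); rewrite -dg_dD !addr0.
rewrite -[dg_d x]/(free_d delta x); move: n i x.
apply: free_ind => [n i|n i x y hx hy|n i x hx|||].
- by rewrite free_d0 !gm0 d0.
- by rewrite free_dD !gm_add dg_dD hx hy.
- rewrite free_dN !gmN hx; apply: (@addrI _ (dg_d (free_lift q n i x))).
  by rewrite -dg_dD !subrr d0.
- by rewrite free_d_id gm0 gm_id dg_d_id.
- by move=> n i e; rewrite free_d_gen free_lift_gen dq.
- move=> k m n p i j l h x y hx hy.
  have hl : composable k m n p (i + 1) j (l + 1) by comp_lia.
  have hr : composable k m n p i (j + 1) (l + 1) by comp_lia.
  rewrite (free_leibniz _ h hl hr) gm_add gm_sg !gm_comp (dg_leibniz h hl hr).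
  by rewrite hx hy.
Qed.

Definition quasi_free_lift : dgMorphism (quasi_free dd) Q := DgMorphism free_lift_d.
End QuasiFree.

Lemma free_lift_Ainf_m n : (2 <= n)%N ->
  free_lift m_gen n (2 - n%:Z) (Ainf_m n) = m_BRT n (2 - n%:Z).
Proof.
move=> n2; rewrite /Ainf_m; case: eqP => [e|]; first exact: free_lift_gen.
by rewrite n2 eqxx.
Qed.

Lemma m_gen_d n i (e : Ainf_gen n i) :
  free_lift m_gen n (i + 1) (Ainf_delta e) = dg_d (m_gen e).
Proof.
have /andP[n2 /eqP ei] := e; move: e; rewrite ei => e; rewrite /m_gen.
case: n n2 e {ei} => // g g0 e.
(* The bound [g] also suffices for the factors of the compositions, whose arities are smaller. *)
rewrite (@m_BRT_bin g) //; apply: etrans (esym (OBd_m_bin g0)).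
rewrite gmN gm_sum; congr (- _); apply: eq_bigr => i1 _.
rewrite gm_sum; apply: eq_bigr => i2 h2; rewrite gm_sum; apply: eq_bigr => i3 h3.
have i2g : (i2 < g.+1)%N := ltn_ord i2.
by rewrite gm_sg gm_cmp !free_lift_Ainf_m ?(@m_BRT_bin g) //; lia.
Qed.

Lemma ogen_m_tree n i (t : SRT n) (o : orientation (val t)) (hi : i == - (nedges (val t))%:Z) :
  m_tree o hi = ogen n i (val o.2) *~ (-1) ^+ o.1.
Proof. by rewrite /m_tree (ogenE (ordering_valid o.2 hi)). Qed.

Theorem proposition2
    (omega : forall (n : nat) (t : SRT n), orientation (val t)) :
  exists (eps : forall n : nat, BRT n -> int) (f : dgMorphism Ainf OmegaBAs),
    (forall (n : nat) (t : BRT n), eps n t = 1 \/ eps n t = -1) /\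
    (forall n : nat, (2 <= n)%N ->
       f n (2 - n%:Z) (Ainf_m n)
       = \sum_(t : BRT n) m_tree (omega n (val t)) (BRT_degree t) *~ eps n t).
Proof.
(* Both sides orient the same tree, so they differ by a sign, found by sorting both orderings into
   the planar one. *)
have sign (n : nat) (t : BRT n) : exists e : bool, (2 <= n)%N ->
    broot n (2 - n%:Z) (inorder 0 (tree_of (val (val t)))) =
    m_tree (omega n (val t)) (BRT_degree t) *~ (-1) ^+ e.
  set b := tree_of _; have gb : (gaps b).+1 = n by exact: gaps_tree_of.
  have [n2|] := boolP (2 <= n)%N; last by exists false.
  have b0 : (0 < gaps b)%N by lia.
  have rb : (rootgap b < nfin (inorder 0 b))%N.
    by rewrite nfin_inorder; case: (b) b0 => //= l r _; lia.
  have [o so wo] : exists2 o : bool * otree, shape o.2 = val (val t) & well_labelled o.2 /\ 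
      m_tree (omega n (val t)) (BRT_degree t) = ogen n (2 - n%:Z) o.2 *~ (-1) ^+ o.1.
    have /andP[/eqP so wo] := valP (omega n (val t)).2.
    by exists ((omega n (val t)).1, val (omega n (val t)).2) => //; rewrite ogen_m_tree.
  case: wo => wo ->.
  have [e1 h1] := ogen_planar n (2 - n%:Z) (wl_del false (wl_inorder b) rb).
  have [e2 h2] := ogen_planar n (2 - n%:Z) wo.
  rewrite /broot root_label_inorder /break h1 h2 -/(break _ _) shape_break_root //.
  rewrite so tree_ofK ?(valP t) //.
  exists (odd (e1 + rootgap b + e2 + o.1)) => _.
  rewrite -!mulrzA -!exprD !sgE; congr (if _ then _ else _).
  by rewrite !(oddD, oddb); case: e1 {h1}; case: e2 {h2}; case: o.1; case: odd.
(* The signs are extracted from their existence by choice. *)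
pose eps n t : int := (-1) ^+ projT1 (cid (sign n t)).
exists eps, (quasi_free_lift Ainf_dd m_gen_d); split=> [n t|n n2].
  by rewrite /eps; case: (projT1 _); [right|left].
apply: etrans (free_lift_Ainf_m n2) _; apply: eq_bigr => t _.
exact: projT2 (cid (sign n t)) n2.
Qed.
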